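(* Let $s,n,m$ be positive integers with $\gcd(s,n)=\gcd(s,m)=1$ and $n,m\ge 2s+1$. If the cylinder knots $Z(s,n,m)$ and $Z(s,m,n)$ are both weakly stable, then $Z(s,n,m)=Z(s,m,n)$.
   Context: Let $g(t)=2\,|t-\lfloor t\rfloor-\tfrac12|$. Knots $Z(s,an,am)^{(a)}$ and cylinder knots. Let $s,n,m$ be positive integers with $\gcd(s,n)=1$, let $a\ge1$ be an integer with $an\ge 2s+1$ and put $\beta=2\pi/a$. Consider the polygonal path $P:[0,1]\to\mathbb C$, parametrized proportionally to arclength, through the points $P(k/n)=e^{iks\beta/n}$, $k=0,\dots,n$. It avoids $0$; write $P(t)=r(t)e^{i\theta(t)}$ with $\theta$ continuous, $\theta(0)=0$, so $\theta(1)=s\beta$. For $\phi\in[0,1]$ consider the closed curve $t\mapsto\bigl(r(t)e^{2\pi i\theta(t)/\beta},\,g(mt+\phi)\bigr)\in\mathbb C\times\mathbb R=\mathbb R^3$, $t\in[0,1]$ (the billiard curve in a slice of angle $2\pi/a$ of the cylinder $D^2\times[0,1]$ with identified radial faces). $Z(s,an,am)^{(a)}$ is the knot given by this curve for any $\phi$ for which it has no self-intersections; it is independent of the choice up to mirror image. For $n\ge 2s+1$ the cylinder knot $Z(s,n,m)$ is the case $a=1$: it is the billiard knot in the cylinder $D^2\times[0,1]$ given by $t\mapsto(P(t),g(mt+\phi))$ where $P$ runs through the regular star polygon with vertices $e^{2\pi iks/n}$. Stable cylinder knots. $Z^{st}(s,n,m)=\lim_{a\to\infty}Z(s,an,am)^{(a)}$,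 i.e. the common knot $Z(s,an,am)^{(a)}$ for all sufficiently large $a$ (for $\gcd(s,n)=1$ these knots are equal for all large $a$). The cylinder knot $Z(s,n,m)$ is called weakly stable if $Z(s,n,m)=Z^{st}(s,n,m)$. Equality of knots: $K_1=K_2$ means that $K_1$ is equivalent to one of $K_2,-K_2,K_2^*,-K_2^*$, where $-K$ is $K$ with reversed orientation and $K^*$ is the mirror image. *)

(* Defs.v *)
(* R^3 is R * R * R, and C is identified with R * R. *)
From mathcomp Require Import all_boot all_order all_algebra.
From mathcomp Require Import all_classical all_reals all_analysis.

Set Implicit Arguments.
Unset Strict Implicit.
Unset Printing Implicit Defensive.

Import Order.TTheory GRing.Theory Num.Theory.
Import numFieldNormedType.Exports.

Local Open Scope classical_set_scope.
Local Open Scope ring_scope.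

(* Closed curves in R^3 are 1-periodic maps on R, oriented by increasing
   parameter; a knot is one that is injective modulo the period. *)
Definition is_knot (R : realType) (K : R -> R * R * R) : Prop :=
  [/\ continuous K,
      forall t, K (t + 1) = K t
    & forall t u, K t = K u -> exists k : int, u = t + k%:~R].

Definition knot_rev (R : realType) (K : R -> R * R * R) : R -> R * R * R :=
  fun t => K (- t).

Definition knot_mirror (R : realType) (K : R -> R * R * R) : R -> R * R * R :=
  fun t => let: (x, y, z) := K t in (x, y, - z).

Definition homeomorphism (T : topologicalType) (f : T -> T) : Prop :=
  continuous f /\
  exists g : T -> T, [/\ continuous g, cancel f g & cancel g f].

Definition ambient_isotopy (R : realType)
    (H : R -> R * R * R -> R * R * R) : Prop :=
  [/\ {within `[0 : R, 1] `*` [set: R * R * R],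
        continuous (fun p : R * (R * R * R) => H p.1 p.2)},
      forall v, H 0 v = v
    & forall t, 0 <= t <= 1 -> homeomorphism (H t)].

(* Lifts to R of the orientation-preserving homeomorphisms of R/Z. *)
Definition reparametrization (R : realType) (rho : R -> R) : Prop :=
  [/\ continuous rho,
      {homo rho : t u / t < u}
    & forall t, rho (t + 1) = rho t + 1].

Definition knot_equiv (R : realType) (K1 K2 : R -> R * R * R) : Prop :=
  exists H rho, [/\ ambient_isotopy H, reparametrization rho
    & forall t, H 1 (K1 t) = K2 (rho t)].

(* Equality of knots, up to orientation and mirror image. *)
Definition knot_eq (R : realType) (K1 K2 : R -> R * R * R) : Prop :=
  [\/ knot_equiv K1 K2,
      knot_equiv K1 (knot_rev K2),
      knot_equiv K1 (knot_mirror K2)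
    | knot_equiv K1 (knot_mirror (knot_rev K2))].

Definition zigzag (R : realType) (t : R) : R :=
  2 * `|t - (Num.floor t)%:~R - 2^-1|.

Definition slice_angle (R : realType) (a : nat) : R := 2 * pi / a%:R.

(* The polygonal path with vertices P (k/n) = exp (i k s beta / n): its edges
   have equal length, so being parametrized proportionally to arclength means
   being affine on each [k/n, (k+1)/n].  The formula is used for all real t, not
   only on [0, 1]; then P (t + 1) = exp (i s beta) P t. *)
Definition star_path (R : realType) (s n a : nat) (t : R) : R * R :=
  let alpha : R := s%:R * slice_angle R a / n%:R in
  let k := Num.floor (n%:R * t) in
  let u := n%:R * t - k%:~R in
  ((1 - u) * cos (k%:~R * alpha) + u * cos ((k + 1)%:~R * alpha),
   (1 - u) * sin (k%:~R * alpha) + u * sin ((k + 1)%:~R * alpha)).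

Definition star_radius (R : realType) (s n a : nat) (t : R) : R :=
  Num.sqrt ((star_path s n a t).1 ^+ 2 + (star_path s n a t).2 ^+ 2).

(* On [0, 1] these conditions determine theta; on R likewise, with
   theta (t + 1) = theta t + s beta. *)
Definition star_argument (R : realType) (s n a : nat) (theta : R -> R) : Prop :=
  [/\ continuous theta, theta 0 = 0
    & forall t, star_path s n a t =
        (star_radius s n a t * cos (theta t),
         star_radius s n a t * sin (theta t))].

Definition billiard_curve (R : realType) (s n m a : nat) (theta : R -> R)
    (phi : R) : R -> R * R * R :=
  fun t =>
    (star_radius s n a t * cos (2 * pi * theta t / slice_angle R a),
     star_radius s n a t * sin (2 * pi * theta t / slice_angle R a),
     zigzag (m%:R * t + phi)).

(* The knot Z(s,an,am)^(a), as a class for knot_eq: all closed curves that are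
   equal, as knots, to a billiard curve without self-intersections.  Since the
   choice of the phase does not matter, this is a single class.  The arguments
   n and m are not multiplied by a: the slice contains n edges of the path. *)
Definition slice_knot (R : realType) (s n m a : nat) : set (R -> R * R * R) :=
  [set K | exists phi theta,
    [/\ 0 <= phi <= 1, star_argument s n a theta,
        is_knot (billiard_curve s n m a theta phi)
      & knot_eq K (billiard_curve s n m a theta phi)]].
Arguments slice_knot R s n m a : clear implicits.

Definition cylinder_knot (R : realType) (s n m : nat) : set (R -> R * R * R) :=
  slice_knot R s n m 1.
Arguments cylinder_knot R s n m : clear implicits.

(* The limit of the classes slice_knot s n m a, which are the same for all
   sufficiently large a when s and n are coprime. *)
Definition stable_knot (R : realType) (s n m : nat) : set (R -> R * R * R) :=
  [set K | \forall a \near \oo, slice_knot R s n m a K].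
Arguments stable_knot R s n m : clear implicits.

Definition weakly_stable (R : realType) (s n m : nat) : Prop :=
  cylinder_knot R s n m = stable_knot R s n m.

(* Main.v *)
From HB Require Import structures.
Require Import Defs.
From mathcomp Require Import all_boot all_order all_algebra.
From mathcomp Require Import all_classical all_reals all_analysis.
From mathcomp Require Import ring lra.

(** The billiard curve in a thin slice is, up to isotopy, a curve in a solid torus
    which runs [s] times around it while its cross-section describes a Lissajous
    figure with frequencies [n] and [m]; a quarter turn of the cross-section
    exchanges [n] and [m].

    In detail: parametrized by its angle, the curve becomes
    [w |-> (X(w) exp(2 pi i s w), Z(w))] ([billiard_curveE]), where [X] is an
    increasing function of [cos (2 pi n w)] and [Z = g(m t(w) + phi)], [t(w)] being
    the time at which the normalized angle [w] is reached.  Points in the same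
    half-plane bounded by the axis differ by [k / s] in the parameter, so the
    curve is a knot iff [(X, Z)] takes different values at [w] and [w + k / s]
    whenever [s] does not divide [k].  Where the values of [X] agree, a computation
    with sum-to-product formulas shows that the order of the values of [Z] is given
    by two sines; one depends on the phase only, and the other keeps its sign when
    [t(w)] is replaced by [w], because [gcd(s, m) = 1] and [t(w)] is close to [w]
    for a large number [a] of slices ([path_height_order]).  Hence the curve with
    cross-section [(3 + cos (2 pi n w), cos (2 pi (m w + phi)))] has the same
    crossings, and the straight-line homotopy to it has no self-intersection
    ([billiard_to_wave]).  In this model the quarter turn is a product of three
    shears ([quarter_turn]), and a translation of the parameter together with a
    rotation about the axis yields the model for [(m, n)] ([wave_swap]).  So the
    slice knots for [(n, m)] and [(m, n)] agree for each large [a]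
    ([slice_knot_swap]), the phase of the second curve being computed from that of
    the first, and weak stability identifies the cylinder knots with these.

    The homotopies have to be turned into ambient isotopies, of curves with
    corners.  If [K1 - K0] is a contraction of [K0], it extends to a contraction
    [f] of R^3 by McShane's formula, and [v + t f(v)] is an isotopy by Banach's
    fixed point theorem ([knot_equiv_near]).  A homotopy whose displacement is
    uniformly Lipschitz along the intermediate curves is a product of such small
    steps ([knot_equiv_linear_homotopy]), and compactness provides this uniform
    bound for curves that wind monotonically around the axis
    ([wound_curve_equiv]). *)

Set Implicit Arguments.
Unset Strict Implicit.
Unset Printing Implicit Defensive.

Import Order.TTheory GRing.Theory Num.Theory.
Import numFieldNormedType.Exports.

Local Open Scope classical_set_scope.
Local Open Scope ring_scope.

(** * Lipschitz maps of complete normed spaces *)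
Section ProductComplete.
Variables U V : completeType.
HB.instance Definition _ := Pointed.on (U * V)%type.

(** Completeness of R^3 is what the fixed point argument below needs. *)
Lemma prod_complete (F : set_system (U * V)) :
  ProperFilter F -> cauchy F -> cvg F.
Proof.
move=> FF Fc.
have /cauchy_cvg cU : cauchy (fst @ F).
  move=> A entA; rewrite near_simpl -near2E near_map2.
  apply: (Fc [set xy | A (xy.1.1, xy.2.1)]).
  exists (A, setT) => /=; first by split => //; exact: entourageT.
  by move=> [[a b] [c d]] /= [Aac _]; exists ((a, c), (b, d)).
have /cauchy_cvg cV : cauchy (snd @ F).
  move=> A entA; rewrite near_simpl -near2E near_map2.
  apply: (Fc [set xy | A (xy.1.2, xy.2.2)]).
  exists (setT, A) => /=; first by split => //; exact: entourageT.
  by move=> [[a b] [c d]] /= [_ Abd]; exists ((a, c), (b, d)).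
apply/cvg_ex; exists (lim (fst @ F), lim (snd @ F)).
have := cvg_pair cU cV.
by rewrite (_ : (fun x => (x.1, x.2)) = id); [apply | apply/funext => -[]].
Qed.

HB.instance Definition _ := Uniform_isComplete.Build (U * V)%type prod_complete.
End ProductComplete.

(** Products, hence R^3, become complete normed modules. *)
HB.instance Definition _ (K : numFieldType) (U V : completeNormedModType K) :=
  NormedModule.on (U * V)%type.

Definition lipschitz_const (R : realType) (U V : normedModType R) (L : R)
    (f : U -> V) : Prop :=
  forall x y, `|f x - f y| <= L * `|x - y|.

Lemma lipschitz_continuous (R : realType) (U V : normedModType R) (L : R)
  (f : U -> V) : lipschitz_const L f -> continuous f.
Proof.
move=> fL x; apply/cvgrPdist_lt => e e0; near=> y.
apply: le_lt_trans (fL _ _) _.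
have L1 : 0 < `|L| + 1 by rewrite ltr_wpDl.
have : `|x - y| < e / (`|L| + 1).
  by near: y; apply: (@cvgr_dist_lt _ _ _ _ _ idfun x) => //; rewrite divr_gt0.
rewrite ltr_pdivlMr // mulrC => /le_lt_trans; apply.
by rewrite ler_wpM2r // (le_trans (ler_norm L)) // lerDl.
Unshelve. all: by end_near. Qed.

(** McShane extension: the infimum of the cones with slope [L] above the
    prescribed values. *)
Lemma lipschitz_extension (R : realType) (V : normedModType R) (I : Type)
    (i0 : I) (p : I -> V) (d : I -> R) (L : R) : 0 <= L ->
  (forall i j, `|d i - d j| <= L * `|p i - p j|) ->
  exists2 f : V -> R, lipschitz_const L (f : V -> R^o) & forall i, f (p i) = d i.
Proof.
move=> L0 dL.
pose S x := range (fun i => d i + L * `|x - p i|).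
have tri x y i : L * `|x - p i| <= L * `|x - y| + L * `|y - p i|.
  by rewrite -mulrDr ler_wpM2l // (le_trans _ (ler_normD _ _)) // addrA subrK.
have SP x : has_inf (S x).
  split; first by exists (d i0 + L * `|x - p i0|); exists i0.
  exists (d i0 - L * `|x - p i0|) => _ [i _ <-].
  have := dL i0 i; rewrite ler_norml => /andP[_]; have := tri (p i0) x i.
  rewrite (distrC (p i0) x); lra.
exists (fun x => inf (S x)).
  suff H x y : inf (S x) <= inf (S y) + L * `|x - y|.
    move=> x y; rewrite ler_norml; have := H x y; have := H y x.
    by rewrite (distrC y); lra.
  rewrite -lerBlDr; apply: lb_le_inf; first by case: (SP y).
  move=> _ [i _ <-]; rewrite lerBlDr.
  apply: (@le_trans _ _ (d i + L * `|x - p i|)).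
    by apply: ge_inf; [case: (SP x) | exists i].
  by have := tri x y i; lra.
move=> i; apply/eqP; rewrite eq_le; apply/andP; split.
  rewrite -[leRHS]addr0 -(mulr0 L) -(normr0 V) -(subrr (p i)).
  by apply: ge_inf; [case: (SP (p i)) | exists i].
apply: lb_le_inf; first by case: (SP (p i)).
by move=> _ [j _ <-]; have := dL i j; rewrite ler_norml => /andP[_]; lra.
Qed.

(** Adding a contraction to the identity stretches distances by at least [1 - L],
    and [v + f v = w] is a fixed point equation for [v |-> w - f v]. *)
Lemma lipschitz_perturbation_homeo (R : realType) (V : completeNormedModType R)
    (L : R) (f : V -> V) : 0 <= L < 1 -> lipschitz_const L f ->
  homeomorphism (fun v => v + f v).
Proof.
move=> /andP[L0 L1] fL.
have expand x y : (1 - L) * `|x - y| <= `|(x + f x) - (y + f y)|.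
  have := fL x y; have := ler_normB ((x + f x) - (y + f y)) (f x - f y).
  by rewrite (_ : _ - _ - _ = x - y); [lra | rewrite opprD addrACA addrK].
split; first by move=> x; apply: continuousD => //; exact: lipschitz_continuous fL _.
have surj w : exists v, v + f v = w.
  have Fp : set_fun setT setT (fun v : V => w - f v) by [].
  pose F : {fun [set: V] >-> [set: V]} := HB.pack (fun v : V => w - f v) (isFun.Build _ _ _ _ _ Fp).
  have Fc : is_contraction F.
    exists (NngNum L0); split => //= -[x y] _ /=.
    by rewrite opprB addrC addrA subrK distrC.
  have [p _ pE] := banach_fixed_point Fc closedT (ex_intro _ 0 I).
  by exists p; rewrite {1}pE subrK.
have [g gK] := choice surj.
exists g; split => //.
- apply: (@lipschitz_continuous _ _ _ (1 - L)^-1) => x y.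
  have := expand (g x) (g y); rewrite !gK => h.
  by rewrite ler_pdivlMl ?subr_gt0.
- move=> x; apply/eqP; rewrite -subr_eq0 -normr_eq0 eq_le normr_ge0 andbT.
  have := expand (g (x + f x)) x; rewrite gK subrr normr0.
  by rewrite pmulr_rle0 ?subr_gt0.
Qed.

(** * Calculus of knot equivalence *)
Section KnotEquivalence.
Variable R : realType.
Implicit Types K : R -> R * R * R.

Lemma homeomorphism_comp (T : topologicalType) (f g : T -> T) :
  homeomorphism f -> homeomorphism g -> homeomorphism (g \o f).
Proof.
move=> [cf [f' [cf' fK f'K]]] [cg [g' [cg' gK g'K]]]; split.
  by move=> x; apply: continuous_comp; [exact: cf | exact: cg].
exists (f' \o g'); split; [|exact: can_comp..].
by move=> x; apply: continuous_comp; [exact: cg' | exact: cf'].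
Qed.

Lemma reparametrization_id : reparametrization (@idfun R).
Proof. by split => // x; exact: cvg_id. Qed.

Lemma ambient_isotopy_id : ambient_isotopy (fun (_ : R) v => v).
Proof.
split => //; first by apply: continuous_subspaceT => p; exact: cvg_snd.
move=> t _; split; first by move=> x; exact: cvg_id.
by exists id; split => // x; exact: cvg_id.
Qed.

Lemma knot_equiv_reparam K0 K1 (rho : R -> R) : reparametrization rho ->
  (forall t, K0 t = K1 (rho t)) -> knot_equiv K0 K1.
Proof.
by move=> rhoP E; exists (fun _ v => v), rho; split => //; exact: ambient_isotopy_id.
Qed.

(** Continuity is only available on [0, 1] * R^3, so the composition is studied
    along the trace of the neighborhood filters on that set. *)
Lemma ambient_isotopy_comp (G H : R -> R * R * R -> R * R * R) :
  ambient_isotopy H -> ambient_isotopy G ->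
  ambient_isotopy (fun t => G t \o H t).
Proof.
move=> [cH H0 hH] [cG G0 hG]; split; last 2 first.
- by move=> v /=; rewrite H0 G0.
- by move=> t t01; apply: homeomorphism_comp; [exact: hH | exact: hG].
move/subspace_continuousP : cH => cH; move/subspace_continuousP : cG => cG.
apply/subspace_continuousP => p pA.
set A := `[0, 1] `*` setT in cH cG pA *.
have cHp : (q.1, H q.1 q.2) @[q --> within A (nbhs p)] -->
    within A (nbhs (p.1, H p.1 p.2)).
  move=> B [] /= [B1 B2] [nB1 nB2] sB.
  have := cH p pA _ nB2; have : within A (nbhs p) [set q | B1 q.1].
    exists (B1, setT); first by split => //; exact: filterT.
    by move=> q [B1q _] _.
  have : within A (nbhs p) A by exact: withinT.
  apply: filterS3 => q Aq B1q B2q.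
  by apply: sB => //; split => //=; case: Aq.
apply: (cvg_comp _ _ cHp (cG (p.1, H p.1 p.2) _)).
by case: pA.
Qed.

Lemma knot_equiv_trans K0 K1 K2 :
  knot_equiv K0 K1 -> knot_equiv K1 K2 -> knot_equiv K0 K2.
Proof.
move=> [H [rho [iH [crho irho prho] HE]]] [G [sigma [iG [csigma isigma psigma] GE]]].
exists (fun t => G t \o H t), (sigma \o rho); split.
- exact: ambient_isotopy_comp.
- split => [x|t u tu|t] /=; last by rewrite prho psigma.
    by apply: continuous_comp; [exact: crho | exact: csigma].
  by apply: isigma; exact: irho.
- by move=> t /=; rewrite HE GE.
Qed.

Lemma knot_equiv_rev K0 K1 :
  knot_equiv K0 K1 -> knot_equiv (knot_rev K0) (knot_rev K1).
Proof.
move=> [H [rho [iH [crho irho prho] HE]]].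
exists H, (fun t => - rho (- t)); split => //.
- split => [x|t u tu|t] /=.
  + apply: continuousN; apply: continuous_comp; last exact: crho.
    exact: continuousN.
  + by rewrite ltrN2; apply: irho; rewrite ltrN2.
  + by have := prho (- t - 1); rewrite subrK opprD => ->; rewrite opprD subrK.
- by move=> t; rewrite /knot_rev HE opprK.
Qed.

Lemma continuous_pair3 (T : topologicalType) (x y z : T -> R) :
  continuous x -> continuous y -> continuous z ->
  continuous (fun t => (x t, y t, z t)).
Proof.
move=> cx cy cz t.
exact: (cvg_pair (cvg_pair (cx t) (cy t)) (cz t)).
Qed.

Let mir (v : R * R * R) : R * R * R := (v.1.1, v.1.2, - v.2).

Lemma mirK : involutive mir.
Proof. by case=> -[x y] z; rewrite /mir /= opprK. Qed.

Lemma mir_continuous : continuous mir.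
Proof.
apply: continuous_pair3 => -[[x y] z].
- by apply: (@continuous_comp _ _ _ fst fst); exact: cvg_fst.
- by apply: (@continuous_comp _ _ _ fst snd); [exact: cvg_fst | exact: cvg_snd].
- by apply: (@continuousN R R^o (R * R * R)%type); exact: cvg_snd.
Qed.

Lemma knot_mirrorE K : knot_mirror K = mir \o K.
Proof. by apply/funext => t; rewrite /knot_mirror /=; case: (K t) => -[]. Qed.

Lemma knot_equiv_mirror K0 K1 :
  knot_equiv K0 K1 -> knot_equiv (knot_mirror K0) (knot_mirror K1).
Proof.
move=> [H [rho [[cH H0 hH] rhoP HE]]]; rewrite !knot_mirrorE.
exists (fun t => mir \o H t \o mir), rho; split => //; last first.
  by move=> t /=; rewrite mirK HE.
split => [|v /=|t t01]; last 2 first.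
- by rewrite H0 mirK.
- have hmir : homeomorphism mir.
    by split; [exact: mir_continuous | exists mir; split => //; [exact: mir_continuous | exact: mirK..]].
  by apply: homeomorphism_comp => //; apply: homeomorphism_comp => //; exact: hH.
move/subspace_continuousP : cH => cH; apply/subspace_continuousP => p pA.
set A := `[0, 1] `*` setT in cH pA *.
have cm : (q.1, mir q.2) @[q --> within A (nbhs p)] -->
    within A (nbhs (p.1, mir p.2)).
  move=> B [] /= [B1 B2] [nB1 nB2] sB.
  exists (B1, mir @^-1` B2) => /=.
    by split => //; exact: mir_continuous.
  by move=> q /= [B1q B2q] Aq; apply: (sB (q.1, mir q.2)) => //.
have pA' : A (p.1, mir p.2) by case: pA.
apply: (cvg_comp _ _ (cvg_comp _ _ cm (cH _ pA'))).
exact: mir_continuous.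
Qed.

(** Equivalences transfer through reversal and mirror image, so the right-hand
    side of [knot_eq] may be replaced by any equivalent curve. *)
Lemma knot_eq_equiv_trans K K0 K1 :
  knot_eq K K0 -> knot_equiv K0 K1 -> knot_eq K K1.
Proof.
move=> KK0 K01; case: KK0 => KK0; [apply: Or41|apply: Or42|apply: Or43|apply: Or44];
  apply: (knot_equiv_trans KK0) => //.
- exact: knot_equiv_rev.
- exact: knot_equiv_mirror.
- by apply: knot_equiv_mirror; exact: knot_equiv_rev.
Qed.

Lemma norm_fst (v : R * R * R) : `|v.1.1| <= `|v|.
Proof. by rewrite !prod_normE !le_max lexx. Qed.

Lemma norm_snd (v : R * R * R) : `|v.1.2| <= `|v|.
Proof. by rewrite !prod_normE !le_max lexx orbT. Qed.

Lemma norm_trd (v : R * R * R) : `|v.2| <= `|v|.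
Proof. by rewrite !prod_normE !le_max lexx orbT. Qed.

Lemma norm_le3 (v : R * R * R) (c : R) :
  `|v.1.1| <= c -> `|v.1.2| <= c -> `|v.2| <= c -> `|v| <= c.
Proof. by rewrite !prod_normE !ge_max => -> -> ->. Qed.

(** Two curves that differ by a contraction of the first one are equivalent: the
    displacement extends, coordinate by coordinate, from the curve to a
    contraction [f] of R^3 (the norm being the sup norm), and [v + t f v] is an
    ambient isotopy.  Only differences of points of the curves enter, so corners
    are harmless. *)
Lemma knot_equiv_near K0 K1 (L : R) : 0 <= L < 1 ->
  (forall t u, `|(K1 t - K0 t) - (K1 u - K0 u)| <= L * `|K0 t - K0 u|) ->
  knot_equiv K0 K1.
Proof.
move=> /andP[L0 L1] KL.
pose D t := K1 t - K0 t.
have [f1 f1L f1E] : exists2 f : R * R * R -> R,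
    lipschitz_const L (f : _ -> R^o) & forall t, f (K0 t) = (D t).1.1.
  apply: (lipschitz_extension 0 L0) => t u.
  by apply: le_trans (KL t u); exact: (norm_fst (D t - D u)).
have [f2 f2L f2E] : exists2 f : R * R * R -> R,
    lipschitz_const L (f : _ -> R^o) & forall t, f (K0 t) = (D t).1.2.
  apply: (lipschitz_extension 0 L0) => t u.
  by apply: le_trans (KL t u); exact: (norm_snd (D t - D u)).
have [f3 f3L f3E] : exists2 f : R * R * R -> R,
    lipschitz_const L (f : _ -> R^o) & forall t, f (K0 t) = (D t).2.
  apply: (lipschitz_extension 0 L0) => t u.
  by apply: le_trans (KL t u); exact: (norm_trd (D t - D u)).
pose f v : R * R * R := (f1 v, f2 v, f3 v).
have fL : lipschitz_const L f.
  move=> x y; apply: norm_le3; [exact: f1L | exact: f2L | exact: f3L].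
have fE t : f (K0 t) = D t by rewrite /f f1E f2E f3E; case: (D t) => -[].
exists (fun t v => v + t *: f v), idfun; split.
- split => [|v|t /andP[t0 t1]]; last 2 first.
  + by rewrite scale0r addr0.
  + apply: (@lipschitz_perturbation_homeo R (R * R * R)%type L (fun v => t *: f v)); first by rewrite L0.
    move=> x y; rewrite -scalerBr normrZ (ger0_norm t0).
    by apply: le_trans (fL x y); rewrite ler_piMl.
  apply: continuous_subspaceT => p; apply: cvgD; first exact: cvg_snd.
  apply: cvgZ; first exact: cvg_fst.
  by apply: continuous_comp; [exact: cvg_snd | exact: lipschitz_continuous fL _].
- exact: reparametrization_id.
- by move=> t; rewrite fE scale1r /D addrC subrK.
Qed.

(** Isotopy extension for straight-line homotopies: if the displacement is
    [C]-Lipschitz along every intermediate curve, cutting the homotopy into more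
    than [C] steps makes each step a contraction. *)
Lemma knot_equiv_linear_homotopy K0 K1 (C : R) :
  (forall tau t u, 0 <= tau <= 1 ->
     `|(K1 t - K0 t) - (K1 u - K0 u)| <=
       C * `|(K0 t + tau *: (K1 t - K0 t)) - (K0 u + tau *: (K1 u - K0 u))|) ->
  knot_equiv K0 K1.
Proof.
move=> KC.
pose D t := K1 t - K0 t.
pose N := (Num.truncn `|C|).+1.
have N0 : 0 < N%:R :> R by [].
have NC : C < N%:R by apply: le_lt_trans (ler_norm C) _; exact: truncnS_gt.
pose Kt (i : nat) t := K0 t + (i%:R / N%:R) *: D t.
suff H i : (i <= N)%N -> knot_equiv K0 (Kt i).
  have := H N (leqnn N); congr (knot_equiv _ _); apply/funext => t.
  by rewrite /Kt divff ?gt_eqF // scale1r /D addrC subrK.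
elim: i => [_|i IH iN].
  apply: (knot_equiv_reparam reparametrization_id) => t.
  by rewrite /Kt mul0r scale0r addr0.
apply: (knot_equiv_trans (IH (ltnW iN))).
have tau01 : 0 <= (i%:R / N%:R : R) <= 1.
  by rewrite divr_ge0 //= ler_pdivrMr // mul1r ler_nat ltnW.
apply: (@knot_equiv_near _ _ (`|C| / N%:R)).
  rewrite divr_ge0 //= ltr_pdivrMr // mul1r; exact: truncnS_gt.
move=> t u.
have DK x : Kt i.+1 x - Kt i x = N%:R^-1 *: D x.
  rewrite /Kt opprD addrACA subrr add0r -scalerBl -mulrBl -natrB // subSnn.
  by rewrite mul1r.
rewrite !DK -scalerBr normrZ ger0_norm ?invr_ge0 // mulrC mulrAC.
rewrite ler_wpM2r ?invr_ge0 //.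
apply: le_trans (KC _ t u tau01) _.
by rewrite ler_wpM2r // ler_norm.
Qed.
End KnotEquivalence.

Section Rotation.
Variables (R : realType).

Definition rotate_z (b : R) (v : R * R * R) : R * R * R :=
  (v.1.1 * cos b - v.1.2 * sin b, v.1.1 * sin b + v.1.2 * cos b, v.2).

Lemma rotate_zD a b v : rotate_z a (rotate_z b v) = rotate_z (a + b) v.
Proof. by rewrite /rotate_z /= cosD sinD; congr (_, _, _); ring. Qed.

Lemma rotate_z0 v : rotate_z 0 v = v.
Proof.
by case: v => -[x y] z; rewrite /rotate_z /= cos0 sin0 !mulr0 !mulr1 subr0 add0r.
Qed.

Lemma rotate_z_continuous (b : R) :
  continuous (fun p : R * (R * R * R) => rotate_z (p.1 * b) p.2).
Proof.
have trig (f : R -> R) : continuous f -> continuous (fun p : R * (R * R * R) => f (p.1 * b)).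
  move=> cf p; apply: (@continuous_comp _ _ _ (fun q : R * (R * R * R) => q.1 * b) f); last exact: cf.
  by apply: cvgM; [exact: cvg_fst | exact: cvg_cst].
have c1 : continuous (fun p : R * (R * R * R) => p.2.1.1).
  move=> p; apply: (@continuous_comp _ _ _ (fun p : R * (R * R * R) => p.2.1) fst); last exact: cvg_fst.
  by apply: (@continuous_comp _ _ _ (@snd R (R * R * R)) fst); [exact: cvg_snd | exact: cvg_fst].
have c2 : continuous (fun p : R * (R * R * R) => p.2.1.2).
  move=> p; apply: (@continuous_comp _ _ _ (fun p : R * (R * R * R) => p.2.1) snd); last exact: cvg_snd.
  by apply: (@continuous_comp _ _ _ (@snd R (R * R * R)) fst); [exact: cvg_snd | exact: cvg_fst].
have c3 : continuous (fun p : R * (R * R * R) => p.2.2).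
  by move=> p; apply: (@continuous_comp _ _ _ (@snd R (R * R * R)) snd); exact: cvg_snd.
have cc := trig _ (@continuous_cos R); have cs := trig _ (@continuous_sin R).
apply: continuous_pair3; last exact: c3.
  by move=> p; apply: cvgB; apply: cvgM; [exact: c1|exact: cc|exact: c2|exact: cs].
by move=> p; apply: cvgD; apply: cvgM; [exact: c1|exact: cs|exact: c2|exact: cc].
Qed.

Lemma rotate_z_isotopy (b : R) : ambient_isotopy (fun t => rotate_z (t * b)).
Proof.
have cr a : continuous (rotate_z a).
  move=> v; have := @rotate_z_continuous a (1, v).
  move=> /(@continuous_comp _ _ _ (fun v : R * R * R => ((1 : R), v))) /=.
  rewrite /comp /= mul1r; apply.
  exact: (cvg_pair (cvg_cst _) cvg_id).
split.
- exact/continuous_subspaceT/rotate_z_continuous.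
- by move=> v; rewrite mul0r rotate_z0.
- move=> t _; split; first exact: cr.
  by exists (rotate_z (- (t * b))); split => [|v|v]; rewrite ?rotate_zD ?addNr ?subrr ?rotate_z0.
Qed.
End Rotation.

(** * Elementary trigonometry *)
Section Trig.
Variable R : realType.
Implicit Types x y : R.

Lemma periodic_int (f : R -> R) (k : int) (t : R) : (forall t, f (t + 1) = f t) ->
  f (t + k%:~R) = f t :> R.
Proof.
move=> fp; have fn n u : f (u + n%:R) = f u.
  elim: n u => [|n IH] u; first by rewrite addr0.
  by rewrite -natr1 addrA fp IH.
case: k => n; first exact: fn.
by rewrite NegzE mulrNz -(fn n.+1 (t - _)) subrK.
Qed.

Lemma cos_int x (k : int) : cos (x + 2 * pi * k%:~R) = cos x :> R.
Proof.
have pi0 : pi != 0 :> R by rewrite gt_eqF // pi_gt0.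
have := @periodic_int (fun t => cos (2 * pi * t)) k (x / (2 * pi)).
rewrite (_ : 2 * pi * (x / (2 * pi) + k%:~R) = x + 2 * pi * k%:~R); last first.
  by move: (@pi R) pi0 => p p0; field.
rewrite (_ : 2 * pi * (x / (2 * pi)) = x); last first.
  by move: (@pi R) pi0 => p p0; field.
apply => t; rewrite (_ : 2 * pi * (t + 1) = 2 * pi * t + pi *+ 2) ?cosD2pi //.
by ring.
Qed.

Lemma sin_int x (k : int) : sin (x + 2 * pi * k%:~R) = sin x :> R.
Proof. by rewrite -!cosBpihalf addrAC cos_int. Qed.

(** A lift of a circle map of degree one commutes with integer translations. *)
Lemma lift_add_int (f : R -> R) (k : int) (t : R) :
  (forall t, f (t + 1) = f t + 1) -> f (t + k%:~R) = f t + k%:~R.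
Proof.
move=> f1; have fp u : f (u + 1) - (u + 1) = f u - u by rewrite f1; ring.
by have := @periodic_int (fun u => f u - u) k t fp; lra.
Qed.

Lemma sin_lipschitz x y : `|sin x - sin y| <= `|x - y|.
Proof.
wlog xy : x y / x <= y.
  by move=> H; case/orP: (le_total x y) => /H //; rewrite distrC (distrC y).
rewrite distrC (distrC x).
have [|c _ ->] := @MVT_segment R sin cos x y xy.
  exact/continuous_subspaceT/continuous_sin.
by rewrite normrM ler_piMl // cos_max.
Qed.

Lemma cos_lipschitz x y : `|cos x - cos y| <= `|x - y|.
Proof.
rewrite -!sinDpihalf; apply: le_trans (sin_lipschitz _ _) _.
by rewrite opprD addrACA subrr addr0.
Qed.


Lemma cos_nonincreasing x y : 0 <= x -> x <= y -> y <= pi -> cos y <= cos x.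
Proof.
move=> x0 xy ypi; rewrite leNgt ltr_cos ?in_itv /= ?x0 ?ypi -?leNgt //.
- by rewrite (le_trans x0).
- by rewrite (le_trans xy).
Qed.

Lemma sin_nondecreasing x y :
  - (pi / 2) <= x -> x <= y -> y <= pi / 2 -> sin x <= sin y.
Proof.
move=> x0 xy ypi; rewrite leNgt ltr_sin ?in_itv /= ?x0 ?ypi -?leNgt //.
- by rewrite (le_trans x0).
- by rewrite (le_trans xy).
Qed.

(** On [0, 1] the sine stays above its chord of slope [cos 1], by the mean value
    theorem; on [1, pi / 2] it is at least [sin 1] while the argument is below 2. *)
Lemma sin_lower_bound x : `|x| <= pi / 2 -> cos 1 / 2 * `|x| <= `|sin x|.
Proof.
wlog x0 : x / 0 <= x.
  move=> H; case/orP: (le_total 0 x) => [/H//|x0]; rewrite -normrN => xpi.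
  by rewrite -(normrN (sin x)) -sinN; apply: H; rewrite ?oppr_ge0.
rewrite (ger0_norm x0) => xpi.
have c1 := @cos1_gt0 R.
have p2 := @pihalf_lt2 R; have p1 := @pihalf_ge1 R; have ppi := @pi_ge2 R.
have small y : 0 <= y -> y <= 1 -> cos 1 * y <= sin y.
  move=> y0 y1.
  have [|c] := @MVT_segment R sin cos 0 y y0.
    exact/continuous_subspaceT/continuous_sin.
  rewrite in_itv /= => /andP[c0 cy]; rewrite sin0 !subr0 => ->.
  by rewrite ler_wpM2r // cos_nonincreasing //; lra.
rewrite ger0_norm; last by rewrite sin_ge0_pi // x0 /=; lra.
have [x1|x1] := leP x 1.
  by apply: le_trans (small _ x0 x1); rewrite ler_wpM2r //; lra.
have := small 1 ler01 (lexx _); have := @sin_nondecreasing 1 x.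
have : cos 1 * x <= cos 1 * 2 :> R by rewrite ler_wpM2l //; lra.
have -> : - (pi / 2) <= 1 :> R by lra.
rewrite (ltW x1) xpi => h1 /(_ isT isT isT); lra.
Qed.
End Trig.

(** Linear arithmetic with [pi] as an atom, instead of its defining expression. *)
Ltac pi_lra :=
  match goal with R : realType |- _ =>
    generalize dependent (@pi R); intros; lra end.

Lemma pihalf_bounds (R : realType) : 0 < (pi : R) / 2 <= pi.
Proof.
by rewrite divr_gt0 ?pi_gt0 //= ler_pdivrMr // ler_peMr ?pi_ge0 // ler1n.
Qed.

(** * Curves winding [s] times around the vertical axis *)
Section WoundCurves.
Variables (R : realType) (s : nat).
Hypothesis s_gt0 : (0 < s)%N.
Implicit Types (X Z : R -> R) (t u : R).

(** A closed braid with [s] strands, given by its distance [X] to the axis and its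
    height [Z]; the angle is proportional to the parameter. *)
Definition wound_curve X Z : R -> R * R * R := fun t =>
  (X t * cos (2 * pi * (s%:R * t)), X t * sin (2 * pi * (s%:R * t)), Z t).

(** The points of a wound curve in a given half-plane bounded by the axis are those
    with parameters [t + k / s]; this says that they are distinct. *)
Definition noncrossing X Z := forall t (k : int), ~~ (s%:Z %| k)%Z ->
  ~ (X t = X (t + k%:~R / s%:R) /\ Z t = Z (t + k%:~R / s%:R)).

Definition tame (f : R -> R) :=
  [/\ forall t, f (t + 1) = f t, exists B, forall t, `|f t| <= B
    & exists L, forall t u, `|f t - f u| <= L * `|t - u|].

Lemma tameZ a f : tame f -> tame (fun t => a * f t).
Proof.
move=> [fp [B fB] [L fL]]; split.
- by move=> t; rewrite fp.
- by exists (`|a| * B) => t; rewrite normrM ler_wpM2l.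
- by exists (`|a| * L) => t u; rewrite -mulrBr normrM -mulrA ler_wpM2l.
Qed.

Lemma tameD f g : tame f -> tame g -> tame (fun t => f t + g t).
Proof.
move=> [fp [B fB] [L fL]] [gp [B' gB] [L' gL]]; split.
- by move=> t; rewrite fp gp.
- by exists (B + B') => t; rewrite (le_trans (ler_normD _ _)) // lerD.
- exists (L + L') => t u; rewrite opprD addrACA mulrDl.
  by rewrite (le_trans (ler_normD _ _)) // lerD.
Qed.

Lemma tameN f : tame f -> tame (fun t => - f t).
Proof.
move=> [fp [B fB] [L fL]]; split; first by move=> t; rewrite fp.
- by exists B => t; rewrite normrN.
- by exists L => t u; rewrite -opprD normrN.
Qed.

Lemma tame_continuous f : tame f -> continuous f.
Proof. by move=> [_ _ [L fL]]; exact: (@lipschitz_continuous R R^o R^o L). Qed.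

Lemma wound_curve_lipschitz X Z B L : (forall t, `|X t| <= B) ->
  (forall t u, `|X t - X u| <= L * `|t - u|) ->
  (forall t u, `|Z t - Z u| <= L * `|t - u|) ->
  forall t u, `|wound_curve X Z t - wound_curve X Z u| <=
    (L + B * (2 * pi * s%:R)) * `|t - u|.
Proof.
move=> XB XL ZL t u.
have pi0 := @pi_ge0 R.
have B0 : 0 <= B by apply: le_trans (XB 0).
have L0 : 0 <= L.
  by have := XL 1 0; rewrite subr0 normr1 mulr1; apply: le_trans.
have trig (f : R -> R) : (forall x, `|f x| <= 1) ->
    (forall x y, `|f x - f y| <= `|x - y|) ->
    `|X t * f (2 * pi * (s%:R * t)) - X u * f (2 * pi * (s%:R * u))| <=
    (L + B * (2 * pi * s%:R)) * `|t - u|.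
  move=> f1 fL; set a := 2 * pi * _; set b := 2 * pi * _.
  rewrite (_ : _ - _ = (X t - X u) * f a + X u * (f a - f b)); last by ring.
  rewrite (le_trans (ler_normD _ _)) // [leRHS]mulrDl lerD // normrM.
    by rewrite (le_trans _ (XL t u)) // ler_piMr.
  rewrite -[leRHS]mulrA; apply: ler_pM => //; apply: le_trans (fL _ _) _.
  rewrite (_ : a - b = 2 * pi * s%:R * (t - u)); last by rewrite /a /b; ring.
  by rewrite normrM ger0_norm // !mulr_ge0.
apply: (norm_le3 (v := wound_curve X Z t - wound_curve X Z u)).
- exact: (trig cos (@cos_max R) (@cos_lipschitz R)).
- exact: (trig sin (@sin_max R) (@sin_lipschitz R)).
- apply: le_trans (ZL t u) _; rewrite ler_wpM2r // lerDl.
  by rewrite !mulr_ge0.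
Qed.

(** Points at distance at least [r] from the axis are separated by at least a
    multiple of their angular distance: rotating the first point by [- b], either
    its real part is nonpositive, or its imaginary part is controlled by the sine
    of the angle. *)
Lemma angular_gap (x y z z' a b e : R) (k : int) (r : R) :
  0 < r -> r <= x -> r <= y -> `|e| <= 2^-1 -> a - b = 2 * pi * (k%:~R + e) ->
  r * cos 1 * `|e| <=
    `|(x * cos a, x * sin a, z) - (y * cos b, y * sin b, z') : R * R * R|.
Proof.
move=> r0 rx ry e2 ab; set v : R * R * R := _ - _; set N := `|v|.
have c0 := @cos1_gt0 R; have c1 := @cos_le1 R 1.
have pi2 := @pi_ge2 R.
have h1 : `|x * cos a - y * cos b| <= N by exact: (norm_fst v).
have h2 : `|x * sin a - y * sin b| <= N by exact: (norm_snd v).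
have comb p q : `|p| <= 1 -> `|q| <= 1 ->
    `|(x * cos a - y * cos b) * p + (x * sin a - y * sin b) * q| <= 2 * N.
  move=> p1 q1; rewrite (le_trans (ler_normD _ _)) // mulr_natl mulr2n !normrM.
  by apply: lerD; [apply: le_trans h1|apply: le_trans h2]; rewrite ler_piMr.
pose psi := 2 * pi * e.
have abE : a - b = psi + 2 * pi * k%:~R by rewrite ab /psi; ring.
have cE : cos psi = cos a * cos b + sin a * sin b.
  by rewrite -cosB abE cos_int.
have sE : sin psi = sin a * cos b - cos a * sin b.
  by rewrite -sinB abE sin_int.
have psiE : `|psi| = pi * (2 * `|e|).
  by rewrite /psi normrM ger0_norm ?mulr_ge0 ?pi_ge0 //; ring.
have psipi : `|psi| <= pi.
  by rewrite psiE ler_piMr ?pi_ge0 //; lra.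
have e0 : 0 <= `|e| by [].
have [cpos|cneg] := ltP 0 (cos psi); last first.
  have := comb (cos b) (sin b) (cos_max _) (sin_max _).
  rewrite (_ : _ + _ = x * cos psi - y); last first.
    by rewrite cE -[y in RHS]mulr1 -(cos2Dsin2 b); ring.
  rewrite ler0_norm; last first.
    have : x * cos psi <= 0 by rewrite mulr_ge0_le0 //; lra.
    by lra.
  have : x * cos psi <= 0 by rewrite mulr_ge0_le0 //; lra.
  have : r * cos 1 * `|e| <= r * 1 * 2^-1.
    by rewrite ler_pM // ?mulr_ge0 ?ler_pM // ltW.
  lra.
have psi2 : `|psi| <= pi / 2.
  rewrite leNgt; apply/negP => h; move: cpos.
  rewrite -cos_norm ltNge -(cos_pihalf R) cos_nonincreasing // ?ltW //.
  by rewrite divr_gt0 // pi_gt0.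
have := sin_lower_bound psi2.
have := comb (- sin b) (cos b); rewrite normrN => /(_ (sin_max _) (cos_max _)).
rewrite (_ : _ + _ = x * sin psi); last by rewrite sE; ring.
rewrite normrM (ger0_norm (x := x)); last by lra.
rewrite psiE.
move=> h3 h4.
have h5 : r * `|sin psi| <= 2 * N.
  by apply: le_trans h3; rewrite ler_wpM2r.
have h6 : r * (cos 1 / 2 * (pi * (2 * `|e|))) <= 2 * N.
  by apply: le_trans h5; rewrite ler_wpM2l // ltW.
have h7 : r * cos 1 * `|e| * 2 <= r * cos 1 * `|e| * pi.
  by rewrite ler_wpM2l // !mulr_ge0 // ltW.
lra.
Qed.

Lemma wound_curve_continuous (X Z : R -> R) : tame X -> tame Z ->
  continuous (wound_curve X Z).
Proof.
move=> tX tZ.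
have trig (f : R -> R) : continuous f -> continuous (fun t => X t * f (2 * pi * (s%:R * t))).
  move=> cf; have cfl : continuous (f \o (fun t => 2 * pi * (s%:R * t))).
    move=> t; apply: continuous_comp; last exact: cf.
    by apply: cvgM; [exact: cvg_cst | apply: cvgM; [exact: cvg_cst | exact: cvg_id]].
  by move=> t; apply: cvgM; [exact: tame_continuous | exact: cfl].
apply: continuous_pair3; [|  | exact: tame_continuous].
- exact: trig (@continuous_cos R).
- exact: trig (@continuous_sin R).
Qed.

Definition mix (f0 f1 : R -> R) (tau t : R) := f0 t + tau * (f1 t - f0 t).

Lemma mix_tame f0 f1 tau : tame f0 -> tame f1 -> tame (mix f0 f1 tau).
Proof.
move=> f0t f1t; apply: tameD => //; apply: tameZ; apply: tameD => //.
exact: tameN.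
Qed.

Lemma mix_continuous f0 f1 (c : R) : tame f0 -> tame f1 ->
  continuous (fun p : R * R => mix f0 f1 p.2 (p.1 + c)).
Proof.
move=> /tame_continuous c0 /tame_continuous c1 p.
have cs (f : R -> R) : continuous f -> {for p, continuous (fun q : R * R => f (q.1 + c))}.
  move=> cf; apply: (@continuous_comp _ _ _ (fun q : R * R => q.1 + c) f); last exact: cf.
  by apply: cvgD; [exact: cvg_fst | exact: cvg_cst].
apply: cvgD; first exact: cs.
by apply: cvgM; [exact: cvg_snd | apply: cvgB; exact: cs].
Qed.

(** The distance between two strands is a positive continuous function of
    [(t, tau)] in the compact square [0, 1]^2, for each of the finitely many
    residues of [k] modulo [s]; periodicity reduces the general case to this one. *)
Lemma noncrossing_gap X0 X1 Z0 Z1 :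
  tame X0 -> tame X1 -> tame Z0 -> tame Z1 ->
  (forall tau, 0 <= tau <= 1 -> noncrossing (mix X0 X1 tau) (mix Z0 Z1 tau)) ->
  exists2 c : R, 0 < c & forall tau t (k : int), 0 <= tau <= 1 ->
    ~~ (s%:Z %| k)%Z ->
    c <= `|mix X0 X1 tau t - mix X0 X1 tau (t + k%:~R / s%:R)| +
         `|mix Z0 Z1 tau t - mix Z0 Z1 tau (t + k%:~R / s%:R)|.
Proof.
move=> X0t X1t Z0t Z1t nc.
pose G (k : int) (p : R * R) :=
  `|mix X0 X1 p.2 p.1 - mix X0 X1 p.2 (p.1 + k%:~R / s%:R)| +
  `|mix Z0 Z1 p.2 p.1 - mix Z0 Z1 p.2 (p.1 + k%:~R / s%:R)|.
have s0 : s%:R != 0 :> R by rewrite pnatr_eq0 -lt0n.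
have Gc k : continuous (G k).
  have cm f0 f1 : tame f0 -> tame f1 -> continuous
      (fun p : R * R => `|mix f0 f1 p.2 p.1 - mix f0 f1 p.2 (p.1 + k%:~R / s%:R)|).
    move=> f0t f1t p; apply: cvg_norm; apply: cvgB; last exact: mix_continuous.
    have := mix_continuous (c := 0) f0t f1t.
    by under eq_fun do rewrite addr0; apply.
  by move=> p; apply: cvgD; exact: cm.
have onek (k : int) : ~~ (s%:Z %| k)%Z -> exists2 c : R, 0 < c &
    forall t tau, 0 <= t <= 1 -> 0 <= tau <= 1 -> c <= G k (t, tau).
  move=> sk; pose A : set (R * R) := `[0, 1] `*` `[0, 1].
  have A0 : A !=set0 by exists (0, 0); split; rewrite /= in_itv /= lexx ler01.
  have cA : compact A by apply: compact_setX; exact: segment_compact.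
  have cGA : {within A, continuous (G k)} by exact: continuous_subspaceT.
  have [[t0 tau0] t0A Gmin] := compact_EVT_min A0 cA cGA.
  exists (G k (t0, tau0)) => [|t tau t01 tau01]; last first.
    by apply: Gmin; rewrite inE; split; rewrite /= in_itv.
  rewrite lt_def addr_ge0 // andbT paddr_eq0 //= !normr_eq0 !subr_eq0.
  apply/negP => /andP[/eqP eX /eqP eZ].
  have : 0 <= tau0 <= 1 by move: t0A; rewrite inE => -[_]; rewrite /= in_itv.
  by move=> /nc /(_ t0 k sk); apply.
have manyk (j : nat) : exists2 c : R, 0 < c & forall (r : nat) t tau,
    (r < j)%N -> ~~ (s%:Z %| r%:Z)%Z -> 0 <= t <= 1 -> 0 <= tau <= 1 ->
    c <= G r%:Z (t, tau).
  elim: j => [|j [c c0 IH]]; first by exists 1.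
  have [sj|/onek[d d0 dP]] := boolP (s%:Z %| j%:Z)%Z.
    exists c => // r t tau; rewrite ltnS leq_eqVlt => /predU1P[->|]; last exact: IH.
    by rewrite sj.
  exists (Num.min c d) => [|r t tau]; first by rewrite lt_min c0.
  rewrite ltnS leq_eqVlt ge_min => /predU1P[-> _ t1 t2|rj sr t1 t2].
    by rewrite dP ?orbT.
  by rewrite IH.
have [c c0 cP] := manyk s; exists c => // tau t k tau01 sk.
have r0 : (k %% s)%Z = `|(k %% s)%Z|%N.
  by rewrite gez0_abs // modz_ge0 // eqz_nat -lt0n.
have rs : (`|(k %% s)%Z| < s)%N by rewrite -ltz_nat -r0 ltz_pmod.
have sr : ~~ (s%:Z %| `|(k %% s)%Z|%N%:Z)%Z.
  by rewrite -r0; apply: contra sk => /dvdz_mod0P; rewrite modz_mod => /dvdz_mod0P.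
have t01 : 0 <= t - (Num.floor t)%:~R <= 1.
  have := floor_itv t; rewrite intrD => /andP[a b]; rewrite subr_ge0 a /=.
  by rewrite lerBlDl ltW // addrC.
apply: le_trans (cP _ _ _ rs sr t01 tau01) _.
have per (f0 f1 : R -> R) : tame f0 -> tame f1 -> 
    `|mix f0 f1 tau (t - (Num.floor t)%:~R) - mix f0 f1 tau
      (t - (Num.floor t)%:~R + (`|(k %% s)%Z|%N%:Z)%:~R / s%:R)| =
    `|mix f0 f1 tau t - mix f0 f1 tau (t + k%:~R / s%:R)|.
  move=> f0t f1t; have [mp _ _] := mix_tame tau f0t f1t.
  rewrite -(periodic_int (Num.floor t) _ mp) subrK; congr `|_ - _|.
  rewrite -(periodic_int (Num.floor t + (k %/ s)%Z) _ mp) intrD.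
  have kE : k%:~R = (k %/ s)%Z%:~R * s%:R + (k %% s)%Z%:~R :> R.
    by rewrite {1}(divz_eq k s) intrD intrM.
  by congr mix; rewrite kE -r0; field.
by rewrite /G /= !per.
Qed.

(** A straight-line homotopy through noncrossing wound curves is realized by an
    ambient isotopy.  Write [s (t - u) = k + e] with [k] the nearest integer.  If
    [s] divides [k], the two points lie on the same strand: both their
    displacements and their distance are comparable with [|e|], by the Lipschitz
    property and by [angular_gap].  Otherwise they lie near different strands, the
    displacements are bounded, and the distance is bounded below by
    [noncrossing_gap]. *)
Lemma wound_curve_equiv X0 X1 Z0 Z1 (r : R) :
  tame X0 -> tame X1 -> tame Z0 -> tame Z1 ->
  0 < r -> (forall t, r <= X0 t) -> (forall t, r <= X1 t) ->
  (forall tau, 0 <= tau <= 1 -> noncrossing (mix X0 X1 tau) (mix Z0 Z1 tau)) ->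
  knot_equiv (wound_curve X0 Z0) (wound_curve X1 Z1).
Proof.
move=> X0t X1t Z0t Z1t r0 X0r X1r nc.
have [c c0 cP] := noncrossing_gap X0t X1t Z0t Z1t nc.
have bounded (f : R -> R) : tame f -> exists2 B, 0 <= B & forall t, `|f t| <= B.
  move=> [_ [B fB] _]; exists B => //; exact: le_trans (fB 0).
have lip (f : R -> R) : tame f -> exists2 L, 0 <= L & forall t u, `|f t - f u| <= L * `|t - u|.
  move=> [_ _ [L fL]]; exists `|L| => // t u.
  by apply: le_trans (fL t u) _; rewrite ler_wpM2r // ler_norm.
have [BX0 BX00 X0B] := bounded _ X0t; have [BX1 BX10 X1B] := bounded _ X1t.
have [BZ0 BZ00 Z0B] := bounded _ Z0t; have [BZ1 BZ10 Z1B] := bounded _ Z1t.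
have [LX0 LX00 X0L] := lip _ X0t; have [LX1 LX10 X1L] := lip _ X1t.
have [LZ0 LZ00 Z0L] := lip _ Z0t; have [LZ1 LZ10 Z1L] := lip _ Z1t.
pose B := BX0 + BX1 + BZ0 + BZ1.
pose L := LX0 + LX1 + LZ0 + LZ1.
pose W := L + B * (2 * pi * s%:R).
have B0 : 0 <= B by rewrite !addr_ge0.
have L0 : 0 <= L by rewrite !addr_ge0.
have W0 : 0 <= W by rewrite addr_ge0 // !mulr_ge0 // pi_ge0.
pose K0 := wound_curve X0 Z0; pose K1 := wound_curve X1 Z1.
pose D t := K1 t - K0 t.
pose K tau := wound_curve (mix X0 X1 tau) (mix Z0 Z1 tau).
have KE tau t : K0 t + tau *: D t = K tau t.
  rewrite /K0 /D /K1 /K /wound_curve /mix.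
  by congr (_, _, _); rewrite /= /GRing.scale /=; ring.
have DE t : D t = wound_curve (fun t => X1 t - X0 t) (fun t => Z1 t - Z0 t) t.
  by congr (_, _, _); rewrite /=; ring.
have mixE (f0 f1 : R -> R) tau t u : mix f0 f1 tau t - mix f0 f1 tau u =
    (1 - tau) * (f0 t - f0 u) + tau * (f1 t - f1 u) by rewrite /mix; ring.
have lipM (f0 f1 : R -> R) l0 l1 tau : 0 <= tau <= 1 ->
    (forall t u, `|f0 t - f0 u| <= l0 * `|t - u|) ->
    (forall t u, `|f1 t - f1 u| <= l1 * `|t - u|) -> l0 + l1 <= L ->
    forall t u, `|mix f0 f1 tau t - mix f0 f1 tau u| <= L * `|t - u|.
  move=> /andP[tau0 tau1] f0L f1L lL t u.
  apply: (@le_trans _ _ ((l0 + l1) * `|t - u|)); last by rewrite ler_wpM2r.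
  rewrite mixE (le_trans (ler_normD _ _)) // [leRHS]mulrDl; apply: lerD.
    by rewrite normrM (le_trans _ (f0L t u)) // ler_piMl // ger0_norm; lra.
  by rewrite normrM (le_trans _ (f1L t u)) // ler_piMl // ger0_norm; lra.
have lipB (f0 f1 : R -> R) l0 l1 :
    (forall t u, `|f0 t - f0 u| <= l0 * `|t - u|) ->
    (forall t u, `|f1 t - f1 u| <= l1 * `|t - u|) -> l0 + l1 <= L ->
    forall t u, `|f1 t - f0 t - (f1 u - f0 u)| <= L * `|t - u|.
  move=> f0L f1L lL t u.
  apply: (@le_trans _ _ ((l0 + l1) * `|t - u|)); last by rewrite ler_wpM2r.
  rewrite (_ : _ - _ = (f1 t - f1 u) - (f0 t - f0 u)); last by ring.
  by rewrite (le_trans (ler_normB _ _)) // [leRHS]mulrDl addrC lerD.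
have LX : LX0 + LX1 <= L by rewrite /L; lra.
have LZ : LZ0 + LZ1 <= L by rewrite /L; lra.
have DB t : `|X1 t - X0 t| <= B /\ `|Z1 t - Z0 t| <= B.
  split; rewrite (le_trans (ler_normB _ _)) //.
    by have := X0B t; have := X1B t; rewrite /B; lra.
  by have := Z0B t; have := Z1B t; rewrite /B; lra.
have DL t u : `|D t - D u| <= W * `|t - u|.
  rewrite !DE; apply: wound_curve_lipschitz => [{}t|{}t {}u|{}t {}u].
  - by case: (DB t).
  - exact: lipB X0L X1L LX _ _.
  - exact: lipB Z0L Z1L LZ _ _.
have KL tau t u : 0 <= tau <= 1 -> `|K tau t - K tau u| <= W * `|t - u|.
  move=> tau01; apply: wound_curve_lipschitz => [{}t|{}t {}u|{}t {}u].
  - have /andP[tau0 tau1] := tau01.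
    rewrite /mix (_ : _ + _ = (1 - tau) * X0 t + tau * X1 t); last by ring.
    rewrite (le_trans (ler_normD _ _)) // !normrM.
    rewrite (ger0_norm tau0) (ger0_norm (x := 1 - tau)) ?subr_ge0 //.
    have : (1 - tau) * `|X0 t| <= 1 * BX0 by apply: ler_pM => //; lra.
    have : tau * `|X1 t| <= 1 * BX1 by apply: ler_pM => //; lra.
    by rewrite /B; lra.
  - exact: lipM tau01 X0L X1L LX _ _.
  - exact: lipM tau01 Z0L Z1L LZ _ _.
have DM t : `|D t| <= B.
  have [h1 h2] := DB t; rewrite DE; apply: norm_le3 => //=; rewrite normrM;
    by rewrite (le_trans _ h1) // ler_piMr ?cos_max ?sin_max.
have mr tau t : 0 <= tau <= 1 -> r <= mix X0 X1 tau t.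
  move=> /andP[tau0 tau1].
  rewrite /mix (_ : _ + _ = (1 - tau) * X0 t + tau * X1 t); last by ring.
  have : (1 - tau) * r <= (1 - tau) * X0 t by rewrite ler_wpM2l //; lra.
  have : tau * r <= tau * X1 t by rewrite ler_wpM2l.
  lra.
have s0 : s%:R != 0 :> R by rewrite pnatr_eq0 -lt0n.
have s1 : 1 <= s%:R :> R by rewrite ler1n.
pose c1 := r * cos 1.
have c10 : 0 < c1 by rewrite mulr_gt0 // cos1_gt0.
pose Q := W / c1.
have Q0 : 0 <= Q by rewrite divr_ge0 // ltW.
(* The first term is for points on the same strand; in the second, 2 B bounds the
   difference of two displacements, and the gap c is at most three times the
   distance between the strands in the sup norm. *)
pose C := Q + 6 * B * (1 + Q) / c.
apply: (@knot_equiv_linear_homotopy _ _ _ C) => tau t u tau01.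
rewrite -/(D t) -/(D u) -/(K0 t) -/(K0 u) !KE; set N := `|K tau t - _|.
pose k := Num.floor (s%:R * (t - u) + 2^-1).
pose e := s%:R * (t - u) - k%:~R.
have e2 : `|e| <= 2^-1.
  have := floor_itv (s%:R * (t - u) + 2^-1); rewrite -/k intrD => /andP[h1 h2].
  by rewrite ler_norml /e; apply/andP; split; lra.
have eN : W * `|e| <= Q * N.
  have : c1 * `|e| <= N.
    apply: (@angular_gap _ _ _ _ _ _ _ k) => //; [exact: mr|exact: mr|].
    by rewrite /e; ring.
  move=> h; rewrite /Q -mulrA ler_wpM2l // ler_pdivlMl //.
pose u' := t + (- k)%:~R / s%:R.
have u'E : u' - u = e / s%:R by rewrite /u' /e intrN; field.
have u'u : `|u' - u| <= `|e|.
  by rewrite u'E normrM ler_piMr // normfV ger0_norm // invf_le1 // ltr0n.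
have N0 : 0 <= N by exact: normr_ge0.
have [sk|sk] := boolP (s%:Z %| k)%Z.
  have -> : D t = D u'.
    rewrite !DE /u'; have /dvdzP[q kE] := sk.
    rewrite (_ : (- k)%:~R / s%:R = (- q)%:~R :> R); last first.
      by rewrite kE !intrN intrM; field.
    rewrite /wound_curve (_ : 2 * pi * (s%:R * (t + (- q)%:~R)) =
      2 * pi * (s%:R * t) + 2 * pi * (s%:Z * - q)%:~R); last by rewrite intrM; ring.
    have [[X0p _ _] [X1p _ _]] := (X0t, X1t); have [[Z0p _ _] [Z1p _ _]] := (Z0t, Z1t).
    by rewrite cos_int sin_int !periodic_int.
  apply: le_trans (DL _ _) _; apply: (@le_trans _ _ (Q * N)).
    by apply: le_trans eN; rewrite ler_wpM2l.
  by rewrite ler_wpM2r // lerDl divr_ge0 ?(ltW c0) // !mulr_ge0 // addr_ge0.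
pose N' := `|K tau t - K tau u'|.
have N'E : c <= 3 * N'.
  have := cP tau t (- k) tau01; rewrite rpredN => /(_ sk).
  rewrite -/u'; set x := mix X0 X1 tau t; set y := mix X0 X1 tau u'.
  have hz := norm_trd (K tau t - K tau u').
  have h1 := norm_fst (K tau t - K tau u').
  have h2 := norm_snd (K tau t - K tau u').
  move: h1 h2 hz; rewrite -/N' /=.
  rewrite (_ : 2 * pi * (s%:R * u') = 2 * pi * (s%:R * t) + 2 * pi * (- k)%:~R).
    rewrite cos_int sin_int -/x -/y; set a := 2 * pi * _.
    rewrite -!mulrBl; move: (x - y) => {x y}x h1 h2 h3.
    have : `|x| <= 2 * N'.
      have {1}-> : x = x * cos a * cos a + x * sin a * sin a.
        by rewrite -[LHS]mulr1 -(cos2Dsin2 a); ring.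
      rewrite (le_trans (ler_normD _ _)) // mulr_natl mulr2n.
      apply: lerD; rewrite normrM; [apply: le_trans h1|apply: le_trans h2];
        by rewrite ler_piMr ?cos_max ?sin_max.
    by lra.
  by rewrite /u'; move: s0 (@pi R) => s0 p; field.
have N'N : N' <= (1 + Q) * N.
  rewrite mulrDl mul1r; apply: le_trans (ler_distD (K tau u) _ _) _.
  rewrite lerD // distrC; apply: le_trans (KL _ _ _ tau01) _.
  by apply: le_trans eN; rewrite ler_wpM2l.
apply: (@le_trans _ _ (2 * B)).
  by rewrite (le_trans (ler_normB _ _)) // mulr_natl mulr2n lerD.
rewrite /C [leRHS]mulrDl ler_wpDl ?(mulr_ge0 Q0 N0) //.
rewrite [leRHS]mulrAC ler_pdivlMr //.
have : B * c <= B * (3 * ((1 + Q) * N)).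
  by rewrite ler_wpM2l //; lra.
lra.
Qed.
End WoundCurves.

(** * The zigzag function *)
Section Zigzag.
Variable R : realType.
Implicit Types t u x y : R.

Definition fpart t : R := t - (Num.floor t)%:~R.

Lemma fpart_ge0 t : 0 <= fpart t.
Proof. by rewrite subr_ge0 floor_le. Qed.

Lemma fpart_lt1 t : fpart t < 1.
Proof. by rewrite ltrBlDr addrC -(intrD _ _ 1) floorD1_gt. Qed.

Lemma floor_int_add (k : int) x : 0 <= x < 1 -> Num.floor (k%:~R + x) = k.
Proof. by move=> x01; apply: floor_def; rewrite intrD; lra. Qed.

Lemma fpart_int_add (k : int) x : 0 <= x < 1 -> fpart (k%:~R + x) = x.
Proof. by move=> x01; rewrite /fpart floor_int_add // addrC addKr. Qed.

Lemma floor_fpart t : t = (Num.floor t)%:~R + fpart t.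
Proof. by rewrite /fpart addrC subrK. Qed.

Lemma zigzagE t : zigzag t = `|2 * fpart t - 1|.
Proof. by rewrite /zigzag -[X in X * _]ger0_norm // -normrM mulrBr divff. Qed.

Lemma zigzag_ge0 t : 0 <= zigzag t.
Proof. by rewrite zigzagE. Qed.

Lemma zigzag_le1 t : zigzag t <= 1.
Proof. by rewrite zigzagE ler_norml; have := fpart_ge0 t; have := fpart_lt1 t; lra. Qed.

(** The zigzag is the minimum of these functions, twice the distance to the
    half-integers; hence its Lipschitz constant. *)
Lemma zigzag_min t (j : int) : zigzag t <= `|2 * (t - j%:~R) - 1|.
Proof.
have z1 := zigzag_le1 t.
have [jt|jt|->] := ltgtP j (Num.floor t); last by rewrite zigzagE.
- apply: le_trans z1 (le_trans _ (ler_norm _)).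
  have : (j + 1)%:~R <= t by rewrite -floor_ge_int lezD1.
  by rewrite intrD; lra.
- apply: le_trans z1 (le_trans _ _); last by rewrite -normrN; exact: ler_norm.
  have : t < j%:~R by rewrite -floor_lt_int.
  lra.
Qed.

Lemma zigzag_lipschitz t u : `|zigzag t - zigzag u| <= 2 * `|t - u|.
Proof.
wlog : t u / zigzag u <= zigzag t.
  by move=> H; case/orP: (le_total (zigzag u) (zigzag t)) => /H //;
    rewrite distrC (distrC t).
move=> ut; rewrite ger0_norm ?subr_ge0 // lerBlDr.
apply: le_trans (zigzag_min t (Num.floor u)) _; rewrite (zigzagE u).
have -> : 2 * `|t - u| = `|2 * (t - u)| by rewrite normrM ger0_norm.
rewrite (le_trans _ (ler_normD _ _)) //.
by rewrite /fpart (_ : 2 * (t - u) + _ = 2 * (t - (Num.floor u)%:~R) - 1) //; ring.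
Qed.

Lemma zigzag_periodic t : zigzag (t + 1) = zigzag t.
Proof.
by rewrite !zigzagE {1}(floor_fpart t) addrAC -(intrD _ _ 1) fpart_int_add // fpart_ge0 fpart_lt1.
Qed.

(** The zigzag and the cosine rise and fall together, since
    [cos (2 pi t) = - cos (pi g(t))] with [pi g(t)] in [0, pi]. *)
Lemma cos_zigzag t : cos (2 * pi * t) = - cos (pi * zigzag t).
Proof.
rewrite {1}(floor_fpart t) mulrDr addrC cos_int zigzagE.
rewrite (_ : pi * _ = `|2 * pi * fpart t - pi|); last first.
  by rewrite (_ : _ - pi = pi * (2 * fpart t - 1)) ?normrM ?(ger0_norm (pi_ge0 R)) //; ring.
by rewrite cos_norm -[in RHS]cosDpi subrK.
Qed.

Lemma zigzag_lt t u : (zigzag t < zigzag u) = (cos (2 * pi * t) < cos (2 * pi * u)).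
Proof.
rewrite !cos_zigzag ltrN2.
have p0 := @pi_gt0 R.
have pz (v : R) : pi * zigzag v \in `[0, pi].
  rewrite in_itv /= mulr_ge0 ?zigzag_ge0 ?(ltW p0) //=.
  by rewrite ler_piMr ?zigzag_le1 // ltW.
rewrite ltr_cos ?pz //.
by rewrite (ltr_pM2l p0).
Qed.

Lemma cosB2pi x y :
  cos (2 * pi * x) - cos (2 * pi * y) = - 2 * sin (pi * (x + y)) * sin (pi * (x - y)) :> R.
Proof.
rewrite (_ : 2 * pi * x = pi * (x + y) + pi * (x - y)); last by ring.
rewrite (_ : 2 * pi * y = pi * (x + y) - pi * (x - y)); last by ring.
by rewrite cosD cosB; ring.
Qed.

Lemma sin_pi_int (k : int) : sin (pi * k%:~R) = 0 :> R.
Proof.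
apply/eqP; rewrite -norm_cos_eq1.
have -> : `|cos (pi * k%:~R : R)| = 1; last by [].
have sqr1 : cos (pi * k%:~R : R) ^+ 2 = 1.
  have := @cos_int R 0 k; rewrite add0r cos0.
  rewrite (_ : 2 * pi * k%:~R = (pi * k%:~R) *+ 2); last by rewrite -mulr_natl; ring.
  by rewrite cos_mulr2n; lra.
by apply/eqP; rewrite -sqr_norm_eq1 ?sqr1.
Qed.

Lemma sin_pi_eq0 x : sin (pi * x) = 0 -> x = (Num.floor x)%:~R :> R.
Proof.
rewrite {1}(floor_fpart x) mulrDr sinD sin_pi_int mul0r add0r => /eqP.
have c0 : cos (pi * (Num.floor x)%:~R) != 0 :> R.
  by rewrite -norm_sin_eq1 sin_pi_int normr0 eq_sym oner_eq0.
rewrite mulf_eq0 (negPf c0) /= => /eqP s0.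
have [f0|f0] := eqVneq (fpart x) 0; first by rewrite {1}(floor_fpart x) f0 addr0.
have : 0 < sin (pi * fpart x).
  have p0 := @pi_gt0 R.
  rewrite sin_gt0_pi // pmulr_rgt0 // lt_def f0 fpart_ge0 /=.
  by rewrite gtr_pMr // fpart_lt1.
by rewrite s0 ltxx.
Qed.

(** A multiple [k / s] that is not an integer is at distance at least [1 / s] from
    the integers, so no zero of [sin (pi x)] is met on the way to [k / s + e]. *)
Lemma sin_pi_sign_stable (s : nat) (k : int) (e : R) : (0 < s)%N -> ~~ (s%:Z %| k)%Z ->
  `|e| < s%:R^-1 ->
  0 < sin (pi * (k%:~R / s%:R)) * sin (pi * (k%:~R / s%:R + e)).
Proof.
move=> s0 sk es; have sR : 0 < s%:R :> R by rewrite ltr0n.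
have p0 := @pi_gt0 R.
set q := (k %/ s)%Z; set r := (k %% s)%Z.
have yE : k%:~R / s%:R = q%:~R + r%:~R / s%:R :> R.
  by rewrite {1}(divz_eq k s) intrD intrM -/q -/r; field; rewrite gt_eqF.
have r1 : 1 <= r.
  have : 0 <= r by rewrite modz_ge0 // eqz_nat -lt0n.
  rewrite le_eqVlt => /predU1P[r0|//]; case/negP: sk.
  by apply/dvdz_mod0P; rewrite -/r -r0.
have r2 : r + 1 <= s%:Z by rewrite lezD1 ltz_pmod.
set f : R := r%:~R / s%:R.
have f1 : s%:R^-1 <= f by rewrite ler_peMl ?invr_ge0 ?ler1z // ltW.
have f2 : f <= 1 - s%:R^-1.
  rewrite ler_pdivrMr // mulrBl mul1r mulVf ?gt_eqF //.
  have : (r + 1)%:~R <= s%:Z%:~R :> R by rewrite ler_int.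
  rewrite intrD.
  rewrite -lerBrDr.
  apply.
have es' : - s%:R^-1 < e < s%:R^-1 by rewrite -ltr_norml.
have i0 : 0 < s%:R^-1 :> R by rewrite invr_gt0.
have sinq x : sin (pi * (q%:~R + x)) = cos (pi * q%:~R) * sin (pi * x) :> R.
  by rewrite mulrDr sinD sin_pi_int mul0r add0r.
rewrite yE -/f -addrA !sinq mulrACA -expr2.
rewrite mulr_gt0 //.
  rewrite exprn_even_gt0 //= -norm_sin_eq1 sin_pi_int normr0 eq_sym oner_eq0 //.
apply: mulr_gt0; apply: sin_gt0_pi.
  by rewrite pmulr_rgt0 // gtr_pMr //; lra.
by rewrite pmulr_rgt0 // gtr_pMr //; lra.
Qed.
End Zigzag.

(** * Edgewise reparametrization of a polygonal path *)
Section FloorExtension.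
Variable R : realType.
Implicit Types (f g : R -> R) (x y : R).

(** The extension to R, commuting with [x |-> x + 1], of a self-map of [0, 1] fixing
    the endpoints. *)
Definition floor_extension f x : R := (Num.floor x)%:~R + f (fpart x).

Definition unit_homeo f := [/\ f 0 = 0, f 1 = 1 &
  forall x y, 0 <= x -> x < y -> y <= 1 -> f x < f y].

Lemma unit_homeo_itv f x : unit_homeo f -> 0 <= x < 1 -> 0 <= f x < 1.
Proof.
move=> [f0 f1 fi] /andP[x0 x1]; rewrite -[X in _ < X]f1 fi // andbT.
move: x0; rewrite le_eqVlt => /predU1P[<-|x0]; first by rewrite f0.
by rewrite -f0 ltW // fi // ltW.
Qed.

Lemma fpart_itv x : 0 <= fpart x < 1.
Proof. by rewrite fpart_ge0 fpart_lt1. Qed.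

Lemma floor_extension_floor f x : unit_homeo f ->
  Num.floor (floor_extension f x) = Num.floor x.
Proof. by move=> fu; apply: floor_int_add; apply: unit_homeo_itv fu (fpart_itv x). Qed.

Lemma floor_extension_fpart f x : unit_homeo f ->
  fpart (floor_extension f x) = f (fpart x).
Proof. by move=> fu; apply: fpart_int_add; apply: unit_homeo_itv fu (fpart_itv x). Qed.

Lemma floor_extensionK f g : unit_homeo f ->
  (forall x, 0 <= x <= 1 -> g (f x) = x) ->
  cancel (floor_extension f) (floor_extension g).
Proof.
move=> fu gf x; rewrite {1}/floor_extension floor_extension_floor //.
rewrite floor_extension_fpart // gf -?floor_fpart //.
by have := fpart_itv x; lra.
Qed.

Lemma floor_extension_lt f : unit_homeo f ->
  {homo floor_extension f : x y / x < y}.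
Proof.
move=> fu x y xy; have [f0 f1 fi] := fu.
have := le_floor (ltW xy); rewrite le_eqVlt => /predU1P[E|xyk].
  rewrite /floor_extension E ltrD2l fi ?fpart_ge0 ?(ltW (fpart_lt1 _)) //.
  by rewrite /fpart E ltrD2r.
rewrite /floor_extension.
have /andP[_ h1] := unit_homeo_itv fu (fpart_itv x).
have /andP[h2 _] := unit_homeo_itv fu (fpart_itv y).
have : (Num.floor x)%:~R + 1 <= (Num.floor y)%:~R :> R.
  by rewrite -(intrD _ _ 1) ler_int lezD1.
by move: h1 h2; lra.
Qed.

Lemma floor_extension_add1 f x : floor_extension f (x + 1) = floor_extension f x + 1.
Proof.
rewrite /floor_extension (_ : Num.floor (x + 1) = Num.floor x + 1); last first.
  by rewrite floorDrz ?floor1.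
rewrite (_ : fpart (x + 1) = fpart x); last first.
  by rewrite {1}(floor_fpart x) addrAC -(intrD _ _ 1) fpart_int_add ?fpart_itv.
by rewrite intrD; ring.
Qed.

Lemma floor_extensionN f x : (forall y, f (1 - y) = 1 - f y) -> f 0 = 0 ->
  floor_extension f (- x) = - floor_extension f x.
Proof.
move=> fs f0; have [x0|x0] := eqVneq (fpart x) 0.
  have xE : x = (Num.floor x)%:~R by rewrite {1}(floor_fpart x) x0 addr0.
  have e0 (k : int) : floor_extension f k%:~R = k%:~R.
    rewrite /floor_extension /fpart (_ : Num.floor _ = k) ?subrr ?f0 ?addr0 //.
    exact: intrKfloor.
  by rewrite xE -intrN !e0 intrN.
have nE : - x = (- Num.floor x - 1)%:~R + (1 - fpart x).
  by rewrite {1}(floor_fpart x) intrB intrN; ring.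
have f01 : 0 <= 1 - fpart x < 1.
  have := fpart_lt1 x; have : 0 < fpart x by rewrite lt_def x0 fpart_ge0.
  lra.
rewrite {1}/floor_extension nE floor_int_add // fpart_int_add // fs.
by rewrite /floor_extension intrB intrN; ring.
Qed.

Lemma floor_extension_lipschitz f (L : R) : unit_homeo f -> 1 <= L ->
  (forall x y, 0 <= x -> x <= y -> y <= 1 -> f y - f x <= L * (y - x)) ->
  forall x y, `|floor_extension f x - floor_extension f y| <= L * `|x - y|.
Proof.
move=> fu L1 fL x y; have [f0 f1 fi] := fu.
wlog xy : x y / x <= y.
  by move=> H; case/orP: (le_total x y) => /H //; rewrite distrC (distrC y).
have mono : floor_extension f x <= floor_extension f y.
  move: xy; rewrite le_eqVlt => /predU1P[->//|xy].
  by rewrite ltW // floor_extension_lt.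
rewrite distrC (distrC x) !ger0_norm ?subr_ge0 //.
rewrite {2}(floor_fpart x) {2}(floor_fpart y) /floor_extension.
have fx := fpart_itv x; have fy := fpart_itv y.
have := le_floor xy; rewrite le_eqVlt => /predU1P[E|xyk].
  have fxy : fpart x <= fpart y by rewrite /fpart E lerD2r.
  rewrite E; have := fL (fpart x) (fpart y); lra.
have : (Num.floor x)%:~R + 1 <= (Num.floor y)%:~R :> R.
  by rewrite -(intrD _ _ 1) ler_int lezD1.
set a : R := (Num.floor x)%:~R; set b : R := (Num.floor y)%:~R => ab.
have : f 1 - f (fpart x) <= L * (1 - fpart x) by apply: fL; lra.
have : f (fpart y) - f 0 <= L * (fpart y - 0) by apply: fL; lra.
have : 1 * (b - (a + 1)) <= L * (b - (a + 1)) by rewrite ler_wpM2r //; lra.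
rewrite f0 f1; lra.
Qed.
End FloorExtension.

(** An increasing bijection of R is continuous, which spares all gluing arguments
    at the integers. *)
Lemma increasing_can_continuous (R : realType) (f g : R -> R) :
  {homo f : x y / x < y} -> {homo g : x y / x < y} ->
  cancel f g -> cancel g f -> continuous f.
Proof.
move=> fi gi fK gK x; apply/cvgrPdist_lt => e e0.
have a1 : g (f x - e) < x by rewrite -[ltRHS]fK; apply: gi; rewrite ltrBlDr ltrDl.
have a2 : x < g (f x + e) by rewrite -[ltLHS]fK; apply: gi; rewrite ltrDl.
near=> y.
have h1 : f x - e < f y.
  by rewrite -[f x - e]gK; apply: fi; near: y; exact: (@cvgr_gt _ _ _ _ idfun x (@cvg_id _ _) _ a1).
have h2 : f y < f x + e.
  by rewrite -[f x + e]gK; apply: fi; near: y; exact: (@cvgr_lt _ _ _ _ idfun x (@cvg_id _ _) _ a2).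
by rewrite ltr_norml; lra.
Unshelve. all: by end_near. Qed.

Section TanHomeo.
Variables (R : realType) (h : R).
Hypothesis h0 : 0 < h.
Hypothesis h1 : h < pi / 2.
Implicit Types x y : R.

(** Along a chord that subtends the angle [2 h], [tan_homeo] converts the fraction
    of the angle into the fraction of the length, and [atan_homeo] converts back. *)
Definition tan_homeo x : R := (1 + tan ((2 * x - 1) * h) / tan h) / 2.
Definition atan_homeo x : R := (1 + atan ((2 * x - 1) * tan h) / h) / 2.

Lemma cos_angle_ge v : -1 <= v <= 1 -> cos h <= cos (v * h).
Proof.
move=> v1; rewrite -(cos_norm (v * h)) normrM (gtr0_norm h0).
have : `|v| <= 1 by rewrite ler_norml.
move=> v2; have : `|v| * h <= 1 * h by rewrite ler_wpM2r // ltW.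
rewrite mul1r => v3; apply: cos_nonincreasing => //.
  by rewrite mulr_ge0 // ltW.
by have := pihalf_bounds R; pi_lra.
Qed.

Lemma cos_h_gt0 : 0 < cos h.
Proof. by rewrite cos_gt0_pihalf // h1 andbT (lt_trans _ h0) // oppr_lt0; case/andP: (pihalf_bounds R). Qed.

Lemma tan_h_gt0 : 0 < tan h.
Proof.
rewrite divr_gt0 ?cos_h_gt0 // sin_gt0_pi // h0 /=.
by have := pihalf_bounds R; pi_lra.
Qed.

Let h_neq0 : h != 0. Proof. by rewrite gt_eqF. Qed.
Let tan_h_neq0 : tan h != 0. Proof. by rewrite gt_eqF // tan_h_gt0. Qed.

Lemma angle_itv v : -1 <= v <= 1 -> v * h \in `](- (pi / 2)), (pi / 2)[.
Proof.
move=> v1; rewrite in_itv /= -ltr_norml normrM (gtr0_norm h0).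
have : `|v| <= 1 by rewrite ler_norml.
move=> v2; have : `|v| * h <= 1 * h by rewrite ler_wpM2r // ltW.
by rewrite mul1r => /le_lt_trans; apply.
Qed.

Lemma tan_homeo_unit : unit_homeo tan_homeo.
Proof.
split.
- rewrite /tan_homeo (_ : (2 * 0 - 1) * h = - h); last by ring.
  by rewrite tanN; field.
- rewrite /tan_homeo (_ : (2 * 1 - 1) * h = h); last by ring.
  by field.
- move=> x y x0 xy y1; rewrite /tan_homeo ltr_pM2r // ltrD2l.
  rewrite ltr_pM2r ?invr_gt0 ?tan_h_gt0 // ltr_tan ?angle_itv //; [|lra..].
  rewrite ltr_pM2r //; lra.
Qed.

Lemma atan_homeo_unit : unit_homeo atan_homeo.
Proof.
have atanh : atan (tan h) = h.
  by rewrite tanK // in_itv /= h1 andbT (lt_trans _ h0) // oppr_lt0; case/andP: (pihalf_bounds R).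
split.
- rewrite /atan_homeo (_ : (2 * 0 - 1) * _ = - tan h); last by ring.
  by rewrite atanN atanh; field.
- rewrite /atan_homeo (_ : (2 * 1 - 1) * _ = tan h); last by ring.
  by rewrite atanh; field.
- move=> x y x0 xy y1; rewrite /atan_homeo ltr_pM2r // ltrD2l.
  rewrite ltr_pM2r ?invr_gt0 // lt_atan //.
  rewrite ltr_pM2r ?tan_h_gt0 //; lra.
Qed.

Lemma tan_homeoK x : 0 <= x <= 1 -> atan_homeo (tan_homeo x) = x.
Proof.
move=> x01; rewrite /atan_homeo {1}/tan_homeo.
rewrite (_ : _ * tan h = tan ((2 * x - 1) * h)); last by field.
rewrite tanK ?angle_itv //; [by field|lra].
Qed.

Lemma atan_homeoK x : 0 <= x <= 1 -> tan_homeo (atan_homeo x) = x.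
Proof.
move=> x01; rewrite /tan_homeo {1}/atan_homeo.
rewrite (_ : _ * h = atan ((2 * x - 1) * tan h)); last by field.
by rewrite atanK; field.
Qed.

Lemma tan_homeo_sym x : tan_homeo (1 - x) = 1 - tan_homeo x.
Proof.
rewrite /tan_homeo (_ : (2 * (1 - x) - 1) * h = - ((2 * x - 1) * h)); last by ring.
by rewrite tanN; field.
Qed.

Lemma sin_le x : 0 <= x -> sin x <= x.
Proof.
move=> x0; have := sin_lipschitz x 0; rewrite sin0 !subr0 (ger0_norm x0).
exact/le_trans/ler_norm.
Qed.

Lemma tan_lipschitz v w : -1 <= v <= 1 -> -1 <= w <= 1 -> v <= w ->
  tan (w * h) - tan (v * h) <= (w - v) * h / cos h ^+ 2.
Proof.
move=> v1 w1 vw; have c0 := cos_h_gt0.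
have cv := cos_angle_ge v1; have cw := cos_angle_ge w1.
have cv0 : 0 < cos (v * h) by lra.
have cw0 : 0 < cos (w * h) by lra.
rewrite (_ : tan _ - _ = sin ((w - v) * h) / (cos (w * h) * cos (v * h))); last first.
  by rewrite /tan mulrBl sinB; field; rewrite !gt_eqF.
have wh : 0 <= (w - v) * h by rewrite mulr_ge0 ?subr_ge0 // ltW.
apply: (@le_trans _ _ ((w - v) * h / (cos (w * h) * cos (v * h)))).
  by rewrite ler_wpM2r ?sin_le // invr_ge0 ltW // mulr_gt0.
rewrite ler_wpM2l // lef_pV2 ?posrE ?mulr_gt0 ?exprn_gt0 //.
by rewrite expr2 ler_pM // ltW.
Qed.

Lemma tan_homeo_lipschitz : exists2 L : R, 1 <= L &
  forall x y, 0 <= x -> x <= y -> y <= 1 ->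
    tan_homeo y - tan_homeo x <= L * (y - x).
Proof.
have c0 := cos_h_gt0; have t0 := tan_h_gt0.
pose L := h / cos h ^+ 2 / tan h.
have L0 : 0 <= L by apply: divr_ge0 (ltW t0); apply: divr_ge0 (ltW h0) _; rewrite exprn_ge0 // ltW.
exists (1 + L) => [|x y x0 xy y1]; first by rewrite lerDl.
have := @tan_lipschitz (2 * x - 1) (2 * y - 1).
rewrite (_ : 2 * y - 1 - (2 * x - 1) = 2 * (y - x)); last by ring.
move=> H.
apply: (@le_trans _ _ (L * (y - x))); last first.
  by rewrite ler_wpM2r ?subr_ge0 // lerDr.
rewrite /tan_homeo (_ : _ - _ =
  (tan ((2 * y - 1) * h) - tan ((2 * x - 1) * h)) / (2 * tan h)); last by field.
rewrite ler_pdivrMr ?(mulr_gt0 _ t0) //.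
rewrite (_ : _ * (2 * tan h) = 2 * (y - x) * h / cos h ^+ 2).
  apply: H; lra.
by rewrite /L; field; rewrite tan_h_neq0 gt_eqF.
Qed.

(** In a thin slice angle and length along an edge are almost proportional.  With
    [v = 2 x - 1], the ratio [tan (v h) / tan h] lies between [v cos h] and
    [v / cos h], because [y <= tan y <= y / cos h] on [0, h]. *)
Lemma tan_homeo_near_id x : 0 <= x <= 1 ->
  `|tan_homeo x - x| <= (cos h)^-1 - 1.
Proof.
wlog x2 : x / 2^-1 <= x.
  move=> H x01; have [|x2] := leP 2^-1 x; first by move=> /H; apply.
  rewrite -normrN (_ : - (_ - _) = tan_homeo (1 - x) - (1 - x)); last first.
    by rewrite tan_homeo_sym; ring.
  by apply: H; lra.
move=> x01; set v := 2 * x - 1.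
have v01 : 0 <= v <= 1 by rewrite /v; lra.
have c0 := cos_h_gt0; have t0 := tan_h_gt0; have c1 := @cos_le1 R h.
pose y := v * h.
have /andP[v0 v1] := v01.
have y0 : 0 <= y by rewrite mulr_ge0 // ltW.
have ych : cos h <= cos y by apply: cos_angle_ge; lra.
have cy : 0 < cos y by lra.
have yh : y <= h by rewrite ler_piMl // ?(ltW h0); lra.
have sinlow z : 0 <= z -> z <= h -> z * cos z <= sin z.
  move=> z0 zh; have [|c] := @MVT_segment R sin cos 0 z z0.
    exact/continuous_subspaceT/continuous_sin.
  rewrite in_itv /= => /andP[cc0 cz]; rewrite sin0 !subr0 => ->.
  rewrite mulrC ler_wpM2r // cos_nonincreasing //.
  by have := pihalf_bounds R; pi_lra.
have tany1 : y <= tan y.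
  by rewrite /tan ler_pdivlMr // sinlow.
have tanh1 : h <= tan h by rewrite /tan ler_pdivlMr // sinlow // ltW.
have tany2 : tan y <= y / cos h.
  rewrite /tan; apply: (@le_trans _ _ (y / cos y)).
    by rewrite ler_wpM2r ?sin_le // invr_ge0 ltW.
  by rewrite ler_wpM2l // lef_pV2 ?posrE.
have tanh2 : tan h <= h / cos h.
  by rewrite /tan ler_wpM2r ?sin_le ?(ltW h0) // invr_ge0 ltW.
have xE : tan_homeo x - x = (tan y / tan h - v) / 2.
  by rewrite /tan_homeo -/v -/y /v; field.
pose q := tan y / tan h.
have q1 : q <= v / cos h.
  rewrite /q ler_pdivrMr //; apply: (le_trans tany2).
  rewrite /y (_ : v * h / cos h = v / cos h * h); last by ring.
  by rewrite ler_wpM2l // divr_ge0 //; lra.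
have q2 : v * cos h <= q.
  rewrite /q ler_pdivlMr //; apply: le_trans tany1.
  apply: (@le_trans _ _ (v * cos h * (h / cos h))).
    by rewrite ler_wpM2l // mulr_ge0 //; lra.
  by rewrite /y (_ : _ * (h / cos h) = v * h) //; field; rewrite gt_eqF.
have k1 : 1 <= (cos h)^-1 by rewrite invf_ge1.
have k2 : 2 - cos h <= (cos h)^-1.
  rewrite -[_^-1]mul1r ler_pdivlMr //.
  have := sqr_ge0 (1 - cos h); lra.
have q1' : q - v <= (cos h)^-1 - 1.
  have : v * ((cos h)^-1 - 1) <= 1 * ((cos h)^-1 - 1).
    by rewrite ler_wpM2r ?subr_ge0 //; lra.
  by move: q1; lra.
have q2' : v - q <= (cos h)^-1 - 1.
  have : v * (1 - cos h) <= 1 * (1 - cos h) by rewrite ler_wpM2r //; lra.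
  by move: q2; lra.
rewrite xE -/q ler_norml; apply/andP; split; lra.
Qed.
End TanHomeo.

(** * Billiard curves as wound curves *)
Lemma tame_zigzag (R : realType) (n : nat) (c : R) :
  tame (fun w => zigzag (n%:R * w + c)).
Proof.
split.
- move=> t; rewrite (_ : _ * (t + 1) + c = n%:R * t + c + n%:~R); last by ring.
  by rewrite periodic_int // => u; exact: zigzag_periodic.
- by exists 1 => t; rewrite ger0_norm ?zigzag_ge0 ?zigzag_le1.
- exists (2 * n%:R) => t u; apply: le_trans (zigzag_lipschitz _ _) _.
  rewrite -mulrA ler_wpM2l // (_ : _ - _ = n%:R * (t - u)); last by ring.
  by rewrite normrM ger0_norm.
Qed.

Section StarPath.
Variables (R : realType) (n : nat) (h : R).
Hypothesis n_gt0 : (0 < n)%N.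
Hypothesis h0 : 0 < h.
Hypothesis h1 : h < pi / 2.
Implicit Types t w : R.

(** Time as a function of the normalized angle [w = theta / (s beta)] for the path
    whose edges subtend the angle [2 h]; [path_angle] is the inverse. *)
Definition path_time w : R := floor_extension (tan_homeo h) (n%:R * w) / n%:R.
Definition path_angle t : R := floor_extension (atan_homeo h) (n%:R * t) / n%:R.

(** Polar equation of the edges: the angle to the middle of an edge has absolute
    value [h * zigzag (n w)]. *)
Definition path_radius w : R := cos h / cos (h * zigzag (n%:R * w)).

Definition path_height (m : nat) (phi w : R) : R :=
  zigzag (m%:R * path_time w + phi).

Let n0 : n%:R != 0 :> R. Proof. by rewrite pnatr_eq0 -lt0n. Qed.
Let n00 : 0 < n%:R :> R. Proof. by rewrite ltr0n. Qed.

Lemma floor_extension_addn f (x : R) (k : nat) :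
  floor_extension f (x + k%:R) = floor_extension f x + k%:R.
Proof.
elim: k => [|k IH]; first by rewrite !addr0.
by rewrite -natr1 !addrA floor_extension_add1 IH.
Qed.

Lemma path_angleK : cancel path_angle path_time.
Proof.
move=> t; rewrite /path_time /path_angle mulrCA divff // mulr1.
have -> := floor_extensionK (atan_homeo_unit h0 h1) (@atan_homeoK _ _ h0 h1) (n%:R * t).
by rewrite mulrAC divff // mul1r.
Qed.

Lemma path_timeK : cancel path_time path_angle.
Proof.
move=> t; rewrite /path_time /path_angle mulrCA divff // mulr1.
have -> := floor_extensionK (tan_homeo_unit h0 h1) (@tan_homeoK _ _ h0 h1) (n%:R * t).
by rewrite mulrAC divff // mul1r.
Qed.

Lemma path_angle_lt : {homo path_angle : t w / t < w}.
Proof.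
move=> t w tw; rewrite /path_angle ltr_pM2r ?invr_gt0 //.
by apply: floor_extension_lt; [exact: atan_homeo_unit | rewrite ltr_pM2l].
Qed.

Lemma path_time_lt : {homo path_time : t w / t < w}.
Proof.
move=> t w tw; rewrite /path_time ltr_pM2r ?invr_gt0 //.
by apply: floor_extension_lt; [exact: tan_homeo_unit | rewrite ltr_pM2l].
Qed.

Lemma path_angle_continuous : continuous path_angle.
Proof.
exact: increasing_can_continuous path_angle_lt path_time_lt path_angleK path_timeK.
Qed.

Lemma path_time_continuous : continuous path_time.
Proof.
exact: increasing_can_continuous path_time_lt path_angle_lt path_timeK path_angleK.
Qed.

Lemma path_angle_add1 t : path_angle (t + 1) = path_angle t + 1.
Proof. by rewrite /path_angle mulrDr mulr1 floor_extension_addn mulrDl divff. Qed.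

Lemma path_time_add1 t : path_time (t + 1) = path_time t + 1.
Proof. by rewrite /path_time mulrDr mulr1 floor_extension_addn mulrDl divff. Qed.

Lemma path_angle_reparametrization : reparametrization path_angle.
Proof.
by split; [exact: path_angle_continuous|exact: path_angle_lt|exact: path_angle_add1].
Qed.

Lemma path_time_reparametrization : reparametrization path_time.
Proof.
by split; [exact: path_time_continuous|exact: path_time_lt|exact: path_time_add1].
Qed.

Lemma path_angle0 : path_angle 0 = 0.
Proof.
rewrite /path_angle mulr0 /floor_extension /fpart floor0 subr0 add0r.
by have [-> _ _] := atan_homeo_unit h0 h1; rewrite mul0r.
Qed.

Lemma cos_zigzag_bounds w : cos h <= cos (h * zigzag w) <= 1.
Proof.
rewrite cos_le1 andbT mulrC; apply: cos_angle_ge => //.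
by rewrite zigzag_le1 (le_trans _ (zigzag_ge0 _)) // lerN10.
Qed.

Lemma path_radius_ge w : cos h <= path_radius w.
Proof.
have c0 := cos_h_gt0 h0 h1; have /andP[cz cz1] := cos_zigzag_bounds (n%:R * w).
by rewrite /path_radius ler_peMr ?(ltW c0) // invf_ge1 // (lt_le_trans c0).
Qed.

Lemma path_radius_gt0 w : 0 < path_radius w.
Proof. exact: lt_le_trans (cos_h_gt0 h0 h1) (path_radius_ge w). Qed.

Lemma tame_path_radius : tame path_radius.
Proof.
have [zp [B zB] [L zL]] := tame_zigzag n (0 : R).
have c0 := cos_h_gt0 h0 h1.
have cz w : 0 < cos (h * zigzag (n%:R * w)).
  by have /andP[cz1 _] := cos_zigzag_bounds (n%:R * w); exact: lt_le_trans cz1.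
split.
- by move=> w; rewrite /path_radius; have := zp w; rewrite !addr0 => ->.
- exists 1 => w; rewrite ger0_norm ?(ltW (path_radius_gt0 _)) //.
  rewrite ler_pdivrMr // mul1r.
  by have /andP[] := cos_zigzag_bounds (n%:R * w).
exists (h * L / cos h) => t u; rewrite /path_radius.
set A := h * _; set B' := h * zigzag (n%:R * u).
have AB : `|A - B'| <= h * L * `|t - u|.
  rewrite -mulrBr normrM (gtr0_norm h0) -mulrA ler_wpM2l ?(ltW h0) //.
  by have := zL t u; rewrite !addr0.
have hA : cos h <= cos A by have /andP[] := cos_zigzag_bounds (n%:R * t).
have hB : cos h <= cos B' by have /andP[] := cos_zigzag_bounds (n%:R * u).
have cA : 0 < cos A by exact: lt_le_trans hA.
have cB : 0 < cos B' by exact: lt_le_trans hB.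
rewrite (_ : _ - _ = cos h * (cos B' - cos A) / (cos A * cos B')); last first.
  by field; rewrite !gt_eqF.
rewrite !normrM normfV normrM (gtr0_norm c0) (gtr0_norm cA) (gtr0_norm cB).
rewrite ler_pdivrMr ?mulr_gt0 //.
have h3 : `|cos B' - cos A| <= h * L * `|t - u|.
  by apply: le_trans (cos_lipschitz _ _) _; rewrite distrC.
have h4 : 0 <= h * L * `|t - u| by apply: le_trans h3.
apply: (@le_trans _ _ (cos h * (h * L * `|t - u|))); first by rewrite ler_wpM2l // ltW.
rewrite (_ : h * L / cos h * `|t - u| * _ = h * L * `|t - u| * (cos A * cos B' / cos h)); last by field; rewrite gt_eqF.
rewrite mulrC ler_wpM2l // ler_pdivlMr //.
by apply: ler_pM; rewrite // ltW.
Qed.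

Lemma tame_path_height (m : nat) (phi : R) :
  tame (path_height m phi).
Proof.
rewrite /path_height; split.
- move=> w; rewrite path_time_add1.
  by have [zp _ _] := tame_zigzag m phi; rewrite zp.
- by exists 1 => w; rewrite ger0_norm ?zigzag_ge0 ?zigzag_le1.
have [_ _ [L zL]] := tame_zigzag m phi.
have L0 : 0 <= L.
  by have := zL 1 0; rewrite subr0 normr1 (mulr1 L); exact: le_trans.
have [M M1 tM] := tan_homeo_lipschitz h0 h1.
exists (L * M) => t u; apply: le_trans (zL _ _) _.
rewrite -mulrA ler_wpM2l // /path_time -mulrBl normrM normfV (gtr0_norm n00).
rewrite ler_pdivrMr //.
apply: le_trans (floor_extension_lipschitz (tan_homeo_unit h0 h1) M1 tM _ _) _.
by rewrite -mulrBr normrM (gtr0_norm n00) (mulrC n%:R) mulrA.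
Qed.
End StarPath.

Section StarPathPolar.
Variables (R : realType) (s n a : nat).
Hypothesis s_gt0 : (0 < s)%N.
Hypothesis n_gt0 : (0 < n)%N.
Hypothesis a_gt0 : (0 < a)%N.

(** Half the angle [s beta / n] subtended by an edge of the star path. *)
Definition half_edge : R := s%:R * pi / (a%:R * n%:R).
Notation h := half_edge.
Hypothesis h1 : h < pi / 2.

Let n0 : n%:R != 0 :> R. Proof. by rewrite pnatr_eq0 -lt0n. Qed.
Let a0 : a%:R != 0 :> R. Proof. by rewrite pnatr_eq0 -lt0n. Qed.
Let s0 : s%:R != 0 :> R. Proof. by rewrite pnatr_eq0 -lt0n. Qed.

Lemma half_edge_gt0 : 0 < h.
Proof. by rewrite divr_gt0 ?mulr_gt0 ?pi_gt0 ?ltr0n. Qed.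
Let h0 := half_edge_gt0.

(** At the fraction [u] of an edge, the angle [eta] to the middle of the edge
    satisfies [tan eta = (2 u - 1) tan h], and the radius is [cos h / cos eta]. *)
Lemma star_path_polar (t : R) : star_path s n a t =
  (path_radius n h (path_angle n h t) * cos (s%:R * slice_angle R a * path_angle n h t),
   path_radius n h (path_angle n h t) * sin (s%:R * slice_angle R a * path_angle n h t)).
Proof.
rewrite /star_path.
have -> : s%:R * slice_angle R a = 2 * h * n%:R.
  by rewrite /half_edge /slice_angle; move: (@pi R) => p; field; rewrite n0 a0.
move: half_edge_gt0 h1; move: half_edge => h' h'0 h'1.
rewrite mulfK //.
rewrite (_ : n%:R * t - _ = fpart (n%:R * t)) //.
set k := Num.floor _; set u := fpart _.
have u01 : 0 <= u <= 1 by have := fpart_itv (n%:R * t); rewrite -/u; lra.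
pose y := floor_extension (atan_homeo h') (n%:R * t).
have au := atan_homeo_unit h'0 h'1.
pose eta := atan ((2 * u - 1) * tan h').
have etaE : 2 * atan_homeo h' u - 1 = eta / h'.
  by rewrite /atan_homeo -/eta; field; rewrite gt_eqF.
have ny : n%:R * path_angle n h' t = y by rewrite /path_angle mulrCA divff // mulr1.
have zy : h' * zigzag y = `|eta|.
  rewrite zigzagE floor_extension_fpart // -/u etaE normrM normfV (gtr0_norm h'0).
  by rewrite mulrCA divff ?mulr1 // gt_eqF.
have angE : 2 * h' * n%:R * path_angle n h' t = 2 * h' * (k%:~R + 2^-1) + eta.
  rewrite (_ : _ * path_angle n h' t = 2 * h' * y); last first.
    by rewrite -ny; ring.
  rewrite /y /floor_extension -/k -/u.
  have -> : atan_homeo h' u = (1 + eta / h') / 2 by rewrite -etaE; field.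
  by field; rewrite gt_eqF.
have ceta : 0 < cos eta.
  by rewrite cos_gt0_pihalf // atan_gtNpi2 atan_ltpi2.
have teta : sin eta * cos h' = (2 * u - 1) * sin h' * cos eta.
  have : tan eta = (2 * u - 1) * tan h' by rewrite /eta atanK.
  rewrite /tan => E; have ch := cos_h_gt0 h'0 h'1.
  rewrite -[sin eta](divfK (lt0r_neq0 ceta)) E.
  by field; rewrite gt_eqF.
rewrite /path_radius ny zy cos_norm angE.
set b := 2 * h' * (k%:~R + 2^-1).
rewrite (_ : k%:~R * (2 * h') = b - h'); last by rewrite /b; field.
rewrite (_ : (k + 1)%:~R * (2 * h') = b + h'); last by rewrite /b intrD; field.
rewrite !cosD !sinD cosN sinN.
have ceta0 : cos eta != 0 by rewrite gt_eqF.
congr (_, _).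
  rewrite (_ : cos h' / cos eta * (cos b * cos eta - sin b * sin eta) =
    cos b * cos h' - sin b * (sin eta * cos h') / cos eta); last by field.
  by rewrite teta; field.
rewrite (_ : cos h' / cos eta * (sin b * cos eta + cos b * sin eta) =
    sin b * cos h' + cos b * (sin eta * cos h') / cos eta); last by field.
by rewrite teta; field.
Qed.

Lemma star_radiusE (t : R) :
  star_radius s n a t = path_radius n h (path_angle n h t).
Proof.
rewrite /star_radius star_path_polar /=.
have := path_radius_gt0 n half_edge_gt0 h1 (path_angle n h t).
move: (path_radius n h _) => r r0; set b := s%:R * _ * _.
by rewrite !exprMn -mulrDr cos2Dsin2 mulr1 sqrtr_sqr gtr0_norm.
Qed.

Definition path_argument (t : R) : R := s%:R * slice_angle R a * path_angle n h t.

Lemma path_argument_star_argument : star_argument s n a path_argument.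
Proof.
split.
- move=> t; apply: cvgM; first exact: cvg_cst.
  exact: path_angle_continuous.
- by rewrite /path_argument path_angle0 // mulr0.
- by move=> t; rewrite star_radiusE star_path_polar.
Qed.

(** Otherwise the intermediate value theorem would give a value with absolute value
    in ]0, pi], where the cosine is less than 1. *)
Lemma cos1_continuous_eq0 (f : R -> R) :
  continuous f -> f 0 = 0 -> (forall t, cos (f t) = 1) -> forall t, f t = 0.
Proof.
move=> cf f0 cf1 t; apply/eqP; rewrite -normr_eq0; apply/negP => /negP ft.
have {}ft : 0 < `|f t| by rewrite lt_def ft normr_ge0.
pose v := Num.min `|f t| pi.
have v0 : 0 < v by rewrite lt_min ft pi_gt0.
have vpi : v <= pi by rewrite ge_min lexx orbT.
have [c cv] : exists c, `|f c| = v.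
  pose F x := `|f x|.
  have cF : continuous F by move=> x; apply: cvg_norm; exact: cf.
  have F0 : F 0 = 0 by rewrite /F f0 normr0.
  have vt : v <= F t by rewrite ge_min lexx.
  have [t0|t0] := leP 0 t.
    have [||c _ cE] := @IVT R F 0 t v t0; last by exists c.
      exact: continuous_subspaceT.
    by rewrite F0 ge_min (ltW v0) le_max vt orbT.
  have [||c _ cE] := @IVT R F t 0 v (ltW t0); last by exists c.
    exact: continuous_subspaceT.
  by rewrite F0 ge_min (ltW v0) orbT le_max vt.
have : cos v < 1.
  by rewrite -(cos0 R) ltr_cos // in_itv /= ?lexx ?pi_ge0 // (ltW v0).
by rewrite -cv cos_norm cf1 ltxx.
Qed.

Lemma star_argument_unique (theta : R -> R) : star_argument s n a theta ->
  theta =1 path_argument.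
Proof.
move=> [ct t0 tE]; have [cp p0 pE] := path_argument_star_argument.
move=> t; apply/eqP; rewrite -subr_eq0; apply/eqP; move: t.
apply: cos1_continuous_eq0.
- by move=> t; apply: cvgB; [exact: ct | exact: cp].
- by rewrite t0 p0 subrr.
- move=> t; have := tE t; rewrite pE => -[].
  have r0 : star_radius s n a t != 0 by rewrite star_radiusE gt_eqF // path_radius_gt0.
  move=> /(mulfI r0) cE /(mulfI r0) sE.
  by rewrite cosB -cE -sE -!expr2 cos2Dsin2.
Qed.

(** Parametrized by its angle, a billiard curve is a wound curve; so the questions
    of self-intersection and isotopy concern only its radius and height. *)
Lemma billiard_curveE (m : nat) (phi : R) (theta : R -> R) (t : R) :
  star_argument s n a theta ->
  billiard_curve s n m a theta phi t =
  wound_curve s (path_radius n h) (path_height n h m phi) (path_angle n h t).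
Proof.
move=> /star_argument_unique thE; rewrite /billiard_curve star_radiusE thE.
rewrite (_ : 2 * pi * path_argument t / slice_angle R a =
  2 * pi * (s%:R * path_angle n h t)); last first.
  rewrite /path_argument /slice_angle.
  have : pi != 0 :> R by rewrite gt_eqF // pi_gt0.
  by move: (@pi R) => p p0; field; rewrite a0 p0.
by rewrite /wound_curve /path_height path_angleK.
Qed.
End StarPathPolar.

(** * Comparison with Lissajous cross-sections *)
Section SameOrder.
Variable R : realType.
Implicit Types x y : R.

Definition same_order x y x' y' := (x < y) = (x' < y') /\ (y < x) = (y' < x').

Lemma same_order_sym x y x' y' : same_order x y x' y' -> same_order x' y' x y.
Proof. by case. Qed.

Lemma same_order_eq x y x' y' : same_order x y x' y' -> x = y -> x' = y'.
Proof. by move=> [+ +] xy; rewrite xy !ltxx => h1 h2; case: ltgtP h1 h2. Qed.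

(** Between two pairs in the same order, a straight-line homotopy cannot create an
    equality. *)
Lemma same_order_mix x y x' y' tau : 0 <= tau <= 1 -> same_order x y x' y' ->
  x + tau * (x' - x) = y + tau * (y' - y) -> x = y.
Proof.
move=> /andP[t0 t1].
have key (a b a' b' : R) : a < b -> a' < b' ->
    a + tau * (a' - a) < b + tau * (b' - b).
  move=> ab ab'.
  rewrite (_ : a + _ = (1 - tau) * a + tau * a'); last by ring.
  rewrite (_ : b + _ = (1 - tau) * b + tau * b'); last by ring.
  have [->|tau0] := eqVneq tau 0; first by rewrite subr0 !mul1r !mul0r !addr0.
  rewrite ler_ltD //; first by rewrite ler_wpM2l ?subr_ge0 // ltW.
  by rewrite ltr_pM2l // lt_def tau0.
have [xy|xy|//] := ltgtP x y => -[h1 h2] E.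
- by have := key x y x' y' xy; rewrite -h1 E ltxx => /(_ xy).
- by have := key y x y' x' xy; rewrite -h2 E ltxx => /(_ xy).
Qed.

(** When two wound curves have the same crossings, with the same strand on top,
    [same_order_mix] shows that an intermediate curve of the straight-line homotopy
    could only meet itself where the first curve does. *)
Lemma noncrossing_mix (s : nat) (X0 X1 Z0 Z1 : R -> R) :
  (forall t (k : int), ~~ (s%:Z %| k)%Z ->
    same_order (X0 t) (X0 (t + k%:~R / s%:R)) (X1 t) (X1 (t + k%:~R / s%:R))) ->
  (forall t (k : int), ~~ (s%:Z %| k)%Z -> X0 t = X0 (t + k%:~R / s%:R) ->
    same_order (Z0 t) (Z0 (t + k%:~R / s%:R)) (Z1 t) (Z1 (t + k%:~R / s%:R))) ->
  noncrossing s X0 Z0 ->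
  forall tau, 0 <= tau <= 1 -> noncrossing s (mix X0 X1 tau) (mix Z0 Z1 tau).
Proof.
move=> HX HZ nc tau tau01 t k sk [eX eZ]; apply: (nc t k sk).
have XE := same_order_mix tau01 (HX t k sk) eX; split=> //.
exact: same_order_mix tau01 (HZ t k sk XE) eZ.
Qed.

Lemma noncrossing_same_order (s : nat) (X0 X1 Z0 Z1 : R -> R) :
  (forall t (k : int), ~~ (s%:Z %| k)%Z ->
    same_order (X0 t) (X0 (t + k%:~R / s%:R)) (X1 t) (X1 (t + k%:~R / s%:R))) ->
  (forall t (k : int), ~~ (s%:Z %| k)%Z -> X0 t = X0 (t + k%:~R / s%:R) ->
    same_order (Z0 t) (Z0 (t + k%:~R / s%:R)) (Z1 t) (Z1 (t + k%:~R / s%:R))) ->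
  noncrossing s X0 Z0 -> noncrossing s X1 Z1.
Proof.
move=> HX HZ nc t k sk [eX eZ]; apply: (nc t k sk).
have XE := same_order_eq (same_order_sym (HX t k sk)) eX; split=> //.
exact: same_order_eq (same_order_sym (HZ t k sk XE)) eZ.
Qed.
End SameOrder.

Section KnotCriterion.
Variables (R : realType) (s : nat).
Hypothesis s_gt0 : (0 < s)%N.
Implicit Types X Z : R -> R.

Let s0 : s%:R != 0 :> R. Proof. by rewrite pnatr_eq0 -lt0n. Qed.

Lemma wound_curve_shift X Z (k : int) (w : R) :
  X w = X (w + k%:~R / s%:R) -> Z w = Z (w + k%:~R / s%:R) ->
  wound_curve s X Z w = wound_curve s X Z (w + k%:~R / s%:R).
Proof.
move=> XE ZE; rewrite /wound_curve -XE -ZE.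
rewrite (_ : 2 * pi * (s%:R * (w + _)) = 2 * pi * (s%:R * w) + 2 * pi * k%:~R).
  by rewrite cos_int sin_int.
by move: (@pi R) => p; field.
Qed.

Lemma wound_curve_inj X Z (w w' : R) : (forall t, 0 < X t) ->
  wound_curve s X Z w = wound_curve s X Z w' ->
  exists k : int, [/\ w' = w + k%:~R / s%:R, X w = X w' & Z w = Z w'].
Proof.
move=> X0; rewrite /wound_curve; set a := 2 * pi * _; set b := 2 * pi * _.
move=> [e1 e2 eZ].
have XE : X w = X w'.
  apply/eqP; rewrite -(eqrXn2 (n := 2)) ?(ltW (X0 _)) //; apply/eqP.
  rewrite -[LHS]mulr1 -[RHS]mulr1 -{1}(cos2Dsin2 a) -(cos2Dsin2 b) !mulrDr -!exprMn.
  by rewrite e1 e2.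
have X00 : X w' != 0 by rewrite gt_eqF.
move: e1 e2; rewrite XE => /(mulfI X00) cE /(mulfI X00) sE.
have c1 : cos (b - a) = 1 by rewrite cosB cE sE -!expr2 cos2Dsin2.
pose y := s%:R * (w' - w).
have baE : b - a = (pi * y) *+ 2 by rewrite /b /a /y -mulr_natl; ring.
have sy : sin (pi * y) = 0.
  apply/eqP; rewrite -sqrf_eq0 sin2cos2; move: c1; rewrite baE cos_mulr2n => c1.
  by apply/eqP; lra.
exists (Num.floor y); split=> //; rewrite -(sin_pi_eq0 sy) /y.
by field.
Qed.
End KnotCriterion.

(** The Lissajous model has radius [3 + cos (2 pi n w)] and height
    [cos (2 pi (m w + phi))].  The radii are functions of [cos (2 pi n w)], both
    increasing, so they always agree on the order of two points; the heights do so
    at the crossings, provided that the slice is thin. *)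
Section Model.
Variables (R : realType) (s n m : nat).
Hypothesis s_gt0 : (0 < s)%N.
Hypothesis n_gt0 : (0 < n)%N.
Hypothesis co_sn : coprime s n.
Hypothesis co_sm : coprime s m.

Let s0 : s%:R != 0 :> R. Proof. by rewrite pnatr_eq0 -lt0n. Qed.
Let n0 : n%:R != 0 :> R. Proof. by rewrite pnatr_eq0 -lt0n. Qed.

Definition wave (n : nat) (c : R) (w : R) : R := cos (2 * pi * (n%:R * w + c)).

Lemma tame_wave (k : nat) (c : R) : tame (wave k c).
Proof.
split.
- move=> t; rewrite /wave (_ : 2 * pi * _ = 2 * pi * (k%:R * t + c) + 2 * pi * k%:~R).
    by rewrite cos_int.
  by ring.
- by exists 1 => t; exact: cos_max.
- exists (2 * pi * k%:R) => t u; apply: le_trans (cos_lipschitz _ _) _.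
  rewrite (_ : _ - _ = 2 * pi * k%:R * (t - u)); last by ring.
  by rewrite normrM ger0_norm // !mulr_ge0 // pi_ge0.
Qed.

Lemma tame_cst (c : R) : tame (fun=> c).
Proof.
split => //; first by exists `|c|.
by exists 0 => t u; rewrite subrr normr0 mul0r.
Qed.

Lemma ndvdz_mul (k : int) (p : nat) : coprime s p -> ~~ (s%:Z %| k)%Z ->
  ~~ (s%:Z %| p%:Z * k)%Z.
Proof. by move=> co sk; rewrite Gauss_dvdzr. Qed.

Variables (h phi : R).
Hypothesis h0 : 0 < h.
Hypothesis h1 : h < pi / 2.
Hypothesis hsmall : ((cos h)^-1 - 1) * m%:R / n%:R < s%:R^-1 / 2.

Lemma path_radius_order (t u : R) : same_order (path_radius n h t)
  (path_radius n h u) (3 + wave n 0 t) (3 + wave n 0 u).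
Proof.
have key (v w : R) : (path_radius n h v < path_radius n h w) = (3 + wave n 0 v < 3 + wave n 0 w).
  rewrite ltrD2l /wave !addr0 -zigzag_lt /path_radius.
  have c0 := cos_h_gt0 h0 h1.
  have cz x : 0 < cos (h * zigzag x).
    by have /andP[cz1 _] := cos_zigzag_bounds h0 h1 x; exact: lt_le_trans cz1.
  rewrite ltr_pM2l // ltf_pV2 ?posrE // ltr_cos; last 2 first.
  - rewrite in_itv /= mulr_ge0 ?(ltW h0) ?zigzag_ge0 //=.
    rewrite (@le_trans _ _ h) // ?ler_piMr ?(ltW h0) ?zigzag_le1 //.
    by have := pihalf_bounds R; pi_lra.
  - rewrite in_itv /= mulr_ge0 ?(ltW h0) ?zigzag_ge0 //=.
    rewrite (@le_trans _ _ h) // ?ler_piMr ?(ltW h0) ?zigzag_le1 //.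
    by have := pihalf_bounds R; pi_lra.
  by rewrite ltr_pM2l.
by split; exact: key.
Qed.

(** At a crossing, [A = n t] and [B = n t + n k / s] satisfy [A + B = j] for an
    integer [j], since [A - B] is not an integer.  The order of the heights at
    phases [C], [E] is the sign of [sin (pi (C + E)) sin (pi (C - E))].  The
    reparametrization is odd, so [C + E] is the same for the billiard curve and for
    the model, while [C - E] moves from [- m k / s] by a quantity [e] less than
    [1 / s], which does not affect the sign of the sine as [s] does not divide
    [m k]. *)
Lemma path_height_order (t : R) (k : int) : ~~ (s%:Z %| k)%Z ->
  wave n 0 t = wave n 0 (t + k%:~R / s%:R) ->
  same_order (path_height n h m phi t) (path_height n h m phi (t + k%:~R / s%:R))
    (wave m phi t) (wave m phi (t + k%:~R / s%:R)).
Proof.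
move=> sk waveE.
set t' := t + _.
pose A := n%:R * t; pose B := n%:R * t'.
have AB : A - B = - (n%:Z * k)%:~R / s%:R.
  by rewrite /A /B /t' intrM; field.
(* A and B are mirror images of each other modulo the integers *)
have sAB : sin (pi * (A + B)) = 0.
  have : cos (2 * pi * A) - cos (2 * pi * B) = 0.
    by move: waveE; rewrite /wave !addr0 => ->; rewrite subrr.
  rewrite cosB2pi => /eqP; rewrite !mulf_eq0 oppr_eq0 pnatr_eq0 /= => /orP[/eqP//|].
  rewrite AB -intrN => sin0; case/negP: (ndvdz_mul co_sn sk).
  have := @sin_pi_sign_stable R s (- (n%:Z * k)) 0 s_gt0.
  rewrite rpredN normr0 invr_gt0 ltr0n s_gt0 addr0 => H.
  apply/negPn/negP => nsk; have := H nsk isT.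
  by rewrite (eqP sin0) mul0r ltxx.
have [j jE] : exists j : int, A + B = j%:~R by exists (Num.floor (A + B)); exact: sin_pi_eq0.
pose F := floor_extension (tan_homeo h).
have FB : F B = j%:~R - F A.
  have -> : B = - A + j%:~R by rewrite -jE; ring.
  rewrite /F lift_add_int; last by move=> x; rewrite floor_extension_add1.
  rewrite floor_extensionN 1?addrC //; last by have [] := tan_homeo_unit h0 h1.
  by move=> y; exact: tan_homeo_sym.
pose d := F A - A.
have dE : `|d| <= (cos h)^-1 - 1.
  rewrite /d /F /floor_extension [X in _ - X]floor_fpart opprD addrACA subrr add0r.
  by apply: tan_homeo_near_id => //; have := fpart_itv A; lra.
pose S := m%:R * (A + B) / n%:R + 2 * phi.
pose e := 2 * m%:R * d / n%:R.
pose k' : int := - (m%:Z * k).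
pose y : R := k'%:~R / s%:R.
have hC : m%:R * path_time n h t + phi + (m%:R * path_time n h t' + phi) = S.
  rewrite /path_time -/A -/B -/F FB /S jE; field.
  exact: n0.
have hD : m%:R * path_time n h t + phi - (m%:R * path_time n h t' + phi) = y + e.
  rewrite /path_time -/A -/B -/F FB /y /k' /e.
  have -> : j%:~R = 2 * A - (A - B) by rewrite -jE; ring.
  by rewrite AB /d intrN !intrM; field; rewrite n0 s0.
have hC' : m%:R * t + phi + (m%:R * t' + phi) = S by rewrite /S /A /B; field; exact: n0.
have hD' : m%:R * t + phi - (m%:R * t' + phi) = y.
  by rewrite /y /k' /t' intrN intrM; field; exact: s0.
have ysk : ~~ (s%:Z %| k')%Z by rewrite rpredN; exact: ndvdz_mul.
have es : `|e| < s%:R^-1.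
  rewrite /e !normrM normfV !normr_nat.
  have : 2 * m%:R * `|d| / n%:R <= 2 * m%:R * ((cos h)^-1 - 1) / n%:R.
    by rewrite ler_wpM2r ?invr_ge0 // ler_wpM2l // mulr_ge0.
  move=> /le_lt_trans; apply.
  by move: hsmall; rewrite (_ : 2 * _ * _ / _ = 2 * (((cos h)^-1 - 1) * m%:R / n%:R)); [lra|ring].
have prod := sin_pi_sign_stable s_gt0 ysk es.
rewrite -/y in prod.
(* The two differences of cosines are proportional with a positive factor. *)
have scale : exists2 c : R, 0 < c & sin (pi * (y + e)) = c * sin (pi * y).
  have sy : sin (pi * y) != 0 by apply: contraTneq prod => ->; rewrite mul0r ltxx.
  exists (sin (pi * y) * sin (pi * (y + e)) / sin (pi * y) ^+ 2).
    by rewrite divr_gt0 // exprn_even_gt0.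
  by field.
have [c c0 cE] := scale.
have dcos : cos (2 * pi * (m%:R * path_time n h t + phi)) -
    cos (2 * pi * (m%:R * path_time n h t' + phi)) =
    c * (cos (2 * pi * (m%:R * t + phi)) - cos (2 * pi * (m%:R * t' + phi))).
  by rewrite !cosB2pi hC hD hC' hD' cE; ring.
rewrite /same_order /path_height !zigzag_lt /wave; split.
  by rewrite -subr_lt0 dcos pmulr_rlt0 // subr_lt0.
by rewrite -subr_gt0 dcos pmulr_rgt0 // subr_gt0.
Qed.
End Model.

(** * Exchanging the two frequencies *)
Section Final.
Variables (R : realType) (s : nat).
Hypothesis s_gt0 : (0 < s)%N.

Let s0 : s%:R != 0 :> R. Proof. by rewrite pnatr_eq0 -lt0n. Qed.

(** The rotation [(x, z) |-> (z, - x)] of the cross-section, as a product of three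
    shears.  Each shear gives a straight-line homotopy, and stays injective on the
    cross-section throughout; the constant 3 keeps the radius at least 1. *)
Lemma quarter_turn (x z : R -> R) : tame x -> tame z ->
  (forall t, `|x t| <= 1) -> (forall t, `|z t| <= 1) ->
  noncrossing s (fun t => 3 + x t) z ->
  knot_equiv (wound_curve s (fun t => 3 + x t) z)
             (wound_curve s (fun t => 3 + z t) (fun t => - x t)).
Proof.
move=> xt zt x1 z1 nc.
have t3 : tame (fun=> 3 : R) by exact: tame_cst.
have xb t : -1 <= x t <= 1 by rewrite -ler_norml.
have zb t : -1 <= z t <= 1 by rewrite -ler_norml.
have xzt : tame (fun t => 3 + (x t + z t)) by exact: tameD t3 (tameD xt zt).
have txN := tameN xt.
have x3 := tameD t3 xt; have z3 := tameD t3 zt.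
apply: (@knot_equiv_trans _ _ (wound_curve s (fun t => 3 + (x t + z t)) z)).
  apply: (@wound_curve_equiv _ _ s_gt0 _ _ _ _ 1) => //.
  - by move=> t; have := xb t; lra.
  - by move=> t; have := xb t; have := zb t; lra.
  move=> tau tau01 t k sk; rewrite /mix => -[].
  set t' := t + _ => eX eZ; apply: (nc t k sk).
  rewrite -/t'; have zE : z t = z t' by move: eZ; rewrite !subrr !mulr0; lra.
  by split => //; move: eX; rewrite zE; lra.
apply: (@knot_equiv_trans _ _ (wound_curve s (fun t => 3 + (x t + z t)) (fun t => - x t))).
  apply: (@wound_curve_equiv _ _ s_gt0 _ _ _ _ 1) => //.
  - by move=> t; have := xb t; have := zb t; lra.
  - by move=> t; have := xb t; have := zb t; lra.
  move=> tau tau01 t k sk; rewrite /mix => -[].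
  set t' := t + _ => eX eZ; apply: (nc t k sk).
  rewrite -/t'; have qE : x t + z t = x t' + z t' by move: eX; rewrite !subrr !mulr0; lra.
  have zE : z t = z t'.
    move: eZ; rewrite (_ : - x t - z t = - (x t + z t)); last by ring.
    by rewrite (_ : - x t' - z t' = - (x t' + z t')) ?qE; [lra | ring].
  by split => //; move: qE; rewrite zE; lra.
apply: (@wound_curve_equiv _ _ s_gt0 _ _ _ _ 1) => //.
- by move=> t; have := xb t; have := zb t; lra.
- by move=> t; have := zb t; lra.
move=> tau tau01 t k sk; rewrite /mix => -[].
set t' := t + _ => eX eZ; apply: (nc t k sk).
rewrite -/t'; have xE : x t = x t' by move: eZ; rewrite !subrr !mulr0; lra.
by split; [rewrite xE | move: eX; rewrite xE; lra].
Qed.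

(** Translating the parameter of both coordinate functions amounts to a rotation
    about the axis. *)
Lemma wound_curve_translate (X Z X' Z' : R -> R) (c : R) :
  (forall t, X t = X' (t + c)) -> (forall t, Z t = Z' (t + c)) ->
  knot_equiv (wound_curve s X Z) (wound_curve s X' Z').
Proof.
move=> XE ZE; exists (fun t => rotate_z (t * (2 * pi * (s%:R * c)))), (fun t => t + c).
split; first exact: rotate_z_isotopy.
  split => [t|t u tu|t]; last by rewrite addrAC.
    by apply: cvgD; [exact: cvg_id | exact: cvg_cst].
  by rewrite ltrD2r.
move=> t; rewrite mul1r /rotate_z /wound_curve /= XE ZE.
set b := 2 * pi * (s%:R * c); set a := 2 * pi * (s%:R * t).
rewrite (_ : 2 * pi * (s%:R * (t + c)) = a + b); last by rewrite /a /b; ring.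
by rewrite cosD sinD; congr (_, _, _); ring.
Qed.

Section Slice.
Variables (n a : nat).
Hypothesis n_gt0 : (0 < n)%N.
Hypothesis a_gt0 : (0 < a)%N.
Notation h := (half_edge R s n a).
Hypothesis h1 : h < pi / 2.
Let h0 : 0 < h. Proof. exact: half_edge_gt0. Qed.

Variables (m : nat) (phi : R) (theta : R -> R).
Hypothesis thetaP : star_argument s n a theta.

Notation X := (path_radius n h).
Notation Z := (path_height n h m phi).

(** Two equal points of the wound curve at [w] and [w + k / s] would be two points
    of the knot whose parameters differ by an integer. *)
Lemma knot_noncrossing :
  is_knot (billiard_curve s n m a theta phi) -> noncrossing s X Z.
Proof.
move=> [_ _ inj] w k sk [XE ZE].
have E := billiard_curveE s_gt0 n_gt0 a_gt0 h1 m phi _ thetaP.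
have [j jE] := inj (path_time n h w) (path_time n h (w + k%:~R / s%:R)) ltac:(
  by rewrite !E !path_timeK //; exact: wound_curve_shift).
have := path_timeK n_gt0 h0 h1 (w + k%:~R / s%:R).
rewrite jE lift_add_int; last exact: path_angle_add1.
rewrite path_timeK // => /addrI ks.
have : k%:~R = (j * s%:Z)%:~R :> R by rewrite intrM ks; field.
by move=> /eqP; rewrite eqr_int => /eqP kE; move: sk; rewrite kE dvdz_mull.
Qed.

Lemma noncrossing_knot :
  noncrossing s X Z -> is_knot (billiard_curve s n m a theta phi).
Proof.
move=> nc.
have E := billiard_curveE s_gt0 n_gt0 a_gt0 h1 m phi _ thetaP.
have tX := tame_path_radius n h0 h1.
have tZ := tame_path_height n_gt0 h0 h1 m phi.
have w1 w (j : int) : wound_curve s X Z (w + j%:~R) = wound_curve s X Z w.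
  have [[Xp _ _] [Zp _ _]] := (tX, tZ).
  rewrite (_ : j%:~R = (j * s%:Z)%:~R / s%:R); last by rewrite intrM; field.
  by rewrite -wound_curve_shift // intrM mulfK // periodic_int.
split.
- have -> : billiard_curve s n m a theta phi = wound_curve s X Z \o path_angle n h.
    by apply/funext => t; rewrite E.
  have cw := wound_curve_continuous tX tZ.
  by move=> t; apply: continuous_comp; [exact: path_angle_continuous | exact: cw].
- by move=> t; rewrite !E path_angle_add1 // (w1 _ 1).
- move=> t u; rewrite !E => /(wound_curve_inj s_gt0 (path_radius_gt0 n h0 h1)).
  move=> [k [wE XE ZE]]; have [sk|sk] := boolP (s%:Z %| k)%Z; last first.
    by case: (nc (path_angle n h t) k sk); rewrite -wE.
  have /dvdzP[j kE] := sk; exists j.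
  apply: (can_inj (path_angleK n_gt0 h0 h1)).
  rewrite wE lift_add_int; last exact: path_angle_add1.
  by rewrite kE intrM mulfK.
Qed.
End Slice.

(** In a thin slice, a billiard curve is isotopic to its Lissajous model, and one is
    a knot whenever the other is noncrossing. *)
Section ModelEquiv.
Variables (n m a : nat).
Hypothesis n_gt0 : (0 < n)%N.
Hypothesis a_gt0 : (0 < a)%N.
Hypothesis co_sn : coprime s n.
Hypothesis co_sm : coprime s m.
Notation h := (half_edge R s n a).
Hypothesis h1 : h < pi / 2.
Let h0 : 0 < h. Proof. exact: half_edge_gt0. Qed.
Hypothesis hsmall : ((cos h)^-1 - 1) * m%:R / n%:R < s%:R^-1 / 2.
Variables (phi : R) (theta : R -> R).
Hypothesis thetaP : star_argument s n a theta.

Notation X := (path_radius n h).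
Notation Z := (path_height n h m phi).
Notation Xw := (fun t => 3 + wave n 0 t : R).
Notation Zw := (wave m phi).

Let tX : tame X. Proof. exact: tame_path_radius. Qed.
Let tZ : tame Z. Proof. exact: tame_path_height. Qed.
Let tXw : tame Xw. Proof. by apply: tameD; [exact: tame_cst | exact: tame_wave]. Qed.
Let tZw : tame Zw. Proof. exact: tame_wave. Qed.

Let X_order t (k : int) : ~~ (s%:Z %| k)%Z ->
  same_order (X t) (X (t + k%:~R / s%:R)) (Xw t) (Xw (t + k%:~R / s%:R)).
Proof. by move=> _; exact: path_radius_order. Qed.

Let Z_order t (k : int) : ~~ (s%:Z %| k)%Z -> X t = X (t + k%:~R / s%:R) ->
  same_order (Z t) (Z (t + k%:~R / s%:R)) (Zw t) (Zw (t + k%:~R / s%:R)).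
Proof.
move=> sk XE; apply: path_height_order => //.
by have := same_order_eq (X_order t sk) XE; lra.
Qed.

Let Zw_order t (k : int) : ~~ (s%:Z %| k)%Z -> Xw t = Xw (t + k%:~R / s%:R) ->
  same_order (Zw t) (Zw (t + k%:~R / s%:R)) (Z t) (Z (t + k%:~R / s%:R)).
Proof.
move=> sk XE; apply: same_order_sym; apply: Z_order => //.
exact: same_order_eq (same_order_sym (X_order t sk)) XE.
Qed.

Lemma wave_noncrossing : noncrossing s X Z -> noncrossing s Xw Zw.
Proof. exact: noncrossing_same_order X_order Z_order. Qed.

Lemma path_noncrossing : noncrossing s Xw Zw -> noncrossing s X Z.
Proof.
apply: noncrossing_same_order Zw_order => t k sk.
exact: same_order_sym (X_order t sk).
Qed.

Let r0 : 0 < Num.min 1 (cos h). Proof. by rewrite lt_min ltr01 cos_h_gt0. Qed.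
Let rX t : Num.min 1 (cos h) <= X t.
Proof. by rewrite ge_min path_radius_ge ?orbT. Qed.
Let rXw t : Num.min 1 (cos h) <= Xw t.
Proof.
have := @cos_geN1 R (2 * pi * (n%:R * t + 0)); rewrite -/(wave n 0 t) => h2.
by rewrite ge_min; apply/orP; left; lra.
Qed.

Lemma billiard_to_wave : noncrossing s X Z ->
  knot_equiv (billiard_curve s n m a theta phi) (wound_curve s Xw Zw).
Proof.
move=> nc; apply: (@knot_equiv_trans _ _ (wound_curve s X Z)).
  apply: (knot_equiv_reparam (path_angle_reparametrization n_gt0 h0 h1)) => t.
  exact: billiard_curveE.
apply: (wound_curve_equiv s_gt0 tX tXw tZ tZw r0 rX rXw).
exact: noncrossing_mix X_order Z_order nc.
Qed.

Lemma wave_to_billiard : noncrossing s Xw Zw ->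
  knot_equiv (wound_curve s Xw Zw) (billiard_curve s n m a theta phi).
Proof.
move=> nc; apply: (@knot_equiv_trans _ _ (wound_curve s X Z)).
  apply: (wound_curve_equiv s_gt0 tXw tX tZw tZ r0 rXw rX).
  apply: noncrossing_mix Zw_order nc => t k sk.
  exact: same_order_sym (X_order t sk).
apply: (knot_equiv_reparam (path_time_reparametrization n_gt0 h0 h1)) => t.
by rewrite (billiard_curveE s_gt0 n_gt0 a_gt0 h1 m phi _ thetaP) path_timeK.
Qed.
End ModelEquiv.

(** After the quarter turn the height is [- cos (2 pi n w)], a cosine with phase
    1/2; translating the parameter by [c = phi / m] absorbs the phase of the radius
    and produces the new phase [1/2 - n c]. *)
Lemma wave_swap (n m : nat) (phi : R) : (0 < m)%N ->
  noncrossing s (fun t => 3 + wave n 0 t) (wave m phi) ->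
  exists phi', [/\ 0 <= phi' <= 1,
    noncrossing s (fun t => 3 + wave m 0 t) (wave n phi') &
    knot_equiv (wound_curve s (fun t => 3 + wave n 0 t) (wave m phi))
               (wound_curve s (fun t => 3 + wave m 0 t) (wave n phi'))].
Proof.
move=> m_gt0 nc; pose c : R := phi / m%:R.
have m0 : m%:R != 0 :> R by rewrite pnatr_eq0 -lt0n.
pose psi : R := 2^-1 - n%:R * c.
pose phi' := fpart psi.
have XE t : 3 + wave m phi t = 3 + wave m 0 (t + c).
  by congr (_ + cos _); rewrite /c; move: (@pi R) => p; field.
have ZE t : - wave n 0 t = wave n phi' (t + c).
  rewrite /wave /phi' /fpart.
  rewrite (_ : 2 * pi * (n%:R * (t + c) + _) =
    2 * pi * (n%:R * t + 0) + pi + 2 * pi * (- Num.floor psi)%:~R).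
    by rewrite cos_int cosDpi.
  by rewrite /psi intrN; move: (@pi R) => p; field.
exists phi'; split.
- by have := fpart_itv psi; rewrite -/phi'; lra.
- move=> t k sk [eX eZ]; apply: (nc (t - c) k sk).
  set u := t - c + _.
  have uc : u + c = t + k%:~R / s%:R by rewrite /u; ring.
  have -> : wave n 0 (t - c) = wave n 0 u.
    have := ZE (t - c); have := ZE u; rewrite uc subrK -eZ; lra.
  split => //; have := XE (t - c); have := XE u; rewrite uc subrK -eX; lra.
apply: (@knot_equiv_trans _ _ (wound_curve s (fun t => 3 + wave m phi t) (fun t => - wave n 0 t))).
  apply: quarter_turn => //; try exact: tame_wave; move=> t; exact: cos_max.
exact: wound_curve_translate XE ZE.
Qed.

(** The smallness condition used in [path_height_order] holds for almost all [a],
    since the angle [half_edge] tends to 0. *)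
Lemma near_small_edge (n m : nat) : (0 < n)%N -> (0 < m)%N ->
  \forall a \near \oo, [/\ (0 < a)%N, half_edge R s n a < pi / 2 &
    ((cos (half_edge R s n a))^-1 - 1) * m%:R / n%:R < s%:R^-1 / 2].
Proof.
move=> n_gt0 m_gt0.
have n0 : 0 < n%:R :> R by rewrite ltr0n.
have m0 : 0 < m%:R :> R by rewrite ltr0n.
have sp : 0 < s%:R :> R by rewrite ltr0n.
pose d : R := n%:R / m%:R * (s%:R^-1 / 2).
have d0 : 0 < d by rewrite mulr_gt0 ?divr_gt0 ?invr_gt0.
have [e /= e0 eP] : \forall x \near (0 : R), (1 + d)^-1 < cos x.
  have cgt : (1 + d)^-1 < cos 0 by rewrite cos0 invf_lt1 ?ltrDl // addr_gt0.
  exact: (@cvgr_gt _ _ _ _ _ _ (@continuous_cos R 0) _ cgt).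
pose b := Num.min e (pi / 2).
have b0 : 0 < b by rewrite lt_min e0; have /andP[] := pihalf_bounds R.
near=> a.
have a1 : s%:R * pi / n%:R / b < a%:R by near: a; exact: nbhs_infty_gtr.
have sn0 : 0 < (s%:R * pi / n%:R : R).
  by apply: divr_gt0 n0; apply: mulr_gt0 sp _; exact: pi_gt0.
have a0 : 0 < a%:R :> R by apply: lt_trans a1; exact: divr_gt0.
have hb : half_edge R s n a < b.
  rewrite /half_edge (_ : _ / _ = s%:R * pi / n%:R / a%:R); last first.
    by move: (@pi R) => p; field; rewrite !gt_eqF.
  by rewrite ltr_pdivrMr // [ltRHS]mulrC -ltr_pdivrMr.
have [he hpi] : half_edge R s n a < e /\ half_edge R s n a < pi / 2.
  by move: hb; rewrite lt_min => /andP[].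
have h0 : 0 < half_edge R s n a by rewrite half_edge_gt0 // -(ltr0n R).
split=> //; first by rewrite -(ltr0n R).
have := eP (half_edge R s n a); rewrite /ball_ /= sub0r normrN (gtr0_norm h0).
move=> /(_ he) hc.
have c0 := cos_h_gt0 h0 hpi.
have : (cos (half_edge R s n a))^-1 < 1 + d.
  by rewrite -[1 + d]invrK ltf_pV2 ?posrE ?invr_gt0 // addr_gt0.
rewrite -ltrBlDl => hd.
rewrite -mulrA -ltr_pdivlMr ?divr_gt0 // invf_div mulrC.
by rewrite mulrC [ltRHS]mulrC.
Unshelve. all: by end_near. Qed.

Lemma slice_knot_swap (n m a : nat) : (0 < n)%N -> (0 < m)%N -> (0 < a)%N ->
  coprime s n -> coprime s m ->
  half_edge R s n a < pi / 2 -> half_edge R s m a < pi / 2 ->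
  ((cos (half_edge R s n a))^-1 - 1) * m%:R / n%:R < s%:R^-1 / 2 ->
  ((cos (half_edge R s m a))^-1 - 1) * n%:R / m%:R < s%:R^-1 / 2 ->
  slice_knot R s n m a `<=` slice_knot R s m n a.
Proof.
move=> n0 m0 a0 con com hn hm en em K [phi [theta [phi01 thP kP KE]]].
have nc := knot_noncrossing n0 a0 hn thP kP.
have ncw := wave_noncrossing n0 a0 con com hn en nc.
have [phi' [phi'01 ncw' sw]] := wave_swap m0 ncw.
have thP' := path_argument_star_argument s_gt0 m0 a0 hm.
have nc' := path_noncrossing m0 a0 com con hm em ncw'.
exists phi', (path_argument s m a); split => //.
  exact: noncrossing_knot.
apply: (knot_eq_equiv_trans KE).
have e1 := billiard_to_wave n0 a0 con com hn en thP nc.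
have e2 := wave_to_billiard m0 a0 com con hm em thP' ncw'.
exact: knot_equiv_trans e1 (knot_equiv_trans sw e2).
Qed.

Lemma stable_knot_swap (n m : nat) : (0 < n)%N -> (0 < m)%N ->
  coprime s n -> coprime s m -> stable_knot R s n m `<=` stable_knot R s m n.
Proof.
move=> n0 m0 con com K; rewrite /stable_knot /=.
have := near_small_edge n0 m0; have := near_small_edge m0 n0.
apply: filterS3 => a [a0 hm em] [_ hn en].
exact: slice_knot_swap.
Qed.
End Final.

Theorem corollary4p4p3 (R : realType) (s n m : nat)
    (s_gt0 : (0 < s)%N) (n_gt0 : (0 < n)%N) (m_gt0 : (0 < m)%N)
    (co_sn : coprime s n) (co_sm : coprime s m)
    (n_ge : (2 * s + 1 <= n)%N) (m_ge : (2 * s + 1 <= m)%N)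
    (wst_snm : weakly_stable R s n m) (wst_smn : weakly_stable R s m n) :
  cylinder_knot R s n m = cylinder_knot R s m n.
Proof.
rewrite wst_snm wst_smn; apply/seteqP; split; exact: stable_knot_swap.
Qed.
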